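(* For $G=CV$ or $G=PCV$, the center $Z(G)$ is trivial.
   Context: Trees. A rooted binary tree is a single vertex or a finite rooted tree in which every non-leaf vertex has a left child and a right child; its $n$ leaves are numbered $1,\dots,n$ from left to right. A caret is the rooted binary tree with two leaves. Attaching a caret to a leaf means identifying the root of the caret with that leaf. Cactus groups. $J_1=\{1\}$; for $n\ge2$, $J_n$ is generated by $s_{i,j}$ $(1\le i<j\le n)$ with relations $s_{i,j}^2=1$; $s_{i,j}s_{k,l}=s_{k,l}s_{i,j}$ for $i<j<k<l$; $s_{i,j}s_{k,l}=s_{i+j-l,i+j-k}s_{i,j}$ for $i\le k<l\le j$. The homomorphism $\pi_n:J_n\to S_n$ sends $s_{i,j}$ to the permutation $m\mapsto i+j-m$ for $i\le m\le j$, fixing all other $m$. Permutations are composed left to right: $(\sigma\tau)(m)=\tau(\sigma(m))$. The cactus Thompson group $CV$. A cactus-tree pair is a triple $(T_+,s,T_-)$ with $T_\pm$ rooted binary trees with the same number $n$ of leaves and $s\in J_n$. For $1\le i\le n$, writing $s=s_{j_1,k_1}\cdots s_{j_l,k_l}$, put $p_1=i$ and let $p_{m+1}$ be the image of $p_m$ under $\pi_n(s_{j_m,k_m})$. Set $s'=s'_1\cdots s'_l\in J_{n+1}$, where $s'_m=s_{j_m,k_m}$ if $k_m<p_m$; $s'_m=s_{p_m,p_m+1}s_{j_m,k_m+1}$ if $j_m\le p_m\le k_m$; $s'_m=s_{j_m+1,k_m+1}$ if $p_m<j_m$. Attaching a caret to leaf $i$ of $T_+$ and to leaf $\pi_n(s)(i)$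 of $T_-$ gives $T'_+,T'_-$; the triple $(T'_+,s',T'_-)$ is called an expansion of $(T_+,s,T_-)$. $CV$ is the set of cactus-tree pairs modulo the equivalence relation generated by expansions. Product: given two classes, choose representatives $(S_+,s,S_-)$, $(T_+,t,T_-)$ with $S_-=T_+$; the product is the class of $(S_+,st,T_-)$. The identity is the class of $(T,1,T)$ and the inverse of $(T_+,s,T_-)$ is $(T_-,s^{-1},T_+)$. Thompson's group $V$ is defined in the same way from tree pairs $(T_+,\sigma,T_-)$ with $\sigma\in S_n$: an expansion attaches a caret to leaf $i$ of $T_+$ and to leaf $\sigma(i)$ of $T_-$ and replaces $\sigma$ by the induced bijection of leaves (left child matched with left child, right child with right child, all other leaves matched as before). The map $\overline\pi:CV\to V$, $(T_+,s,T_-)\mapsto(T_+,\pi_n(s),T_-)$, is a surjective homomorphism, and the pure cactus Thompson group is $PCV:=\ker\overline\pi$. *)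

(* Defs.v *)
From Stdlib Require Import Relations.Relation_Operators Relations.Operators_Properties.
From Stdlib Require Eqdep_dec PeanoNat.
From HB Require Import structures.
From mathcomp Require Import all_boot all_fingroup generic_quotient zify.
From mathcomp Require Import boolp classical_sets.

Set Implicit Arguments.
Unset Strict Implicit.
Unset Printing Implicit Defensive.

Local Open Scope quotient_scope.
Local Open Scope group_scope.

(** Numbering convention: leaves, strands and generators are numbered from 0,
    so that the leaves of a tree with [n] leaves are the elements of ['I_n].
    Products in ['S_n] are read from left to right ([permM]). *)

Inductive tree := Leaf | Node of tree & tree.

HB.instance Definition _ := gen_eqMixin tree.
HB.instance Definition _ := gen_choiceMixin tree.

Fixpoint nleaves (t : tree) : nat :=
  if t is Node l r then (nleaves l + nleaves r)%N else 1%N.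

Definition caret : tree := Node Leaf Leaf.

Fixpoint attach (t : tree) (i : nat) : tree :=
  match t with
  | Leaf => caret
  | Node l r => if (i < nleaves l)%N then Node (attach l i) r
                else Node l (attach r (i - nleaves l))
  end.

Lemma nleaves_gt0 t : (0 < nleaves t)%N.
Proof. by elim: t => //= l IHl r IHr; rewrite addn_gt0 IHl. Qed.

Lemma nleaves_attach t i : nleaves (attach t i) = (nleaves t).+1.
Proof.
by elim: t i => //= l IHl r IHr i; case: ifP => _ /=; rewrite ?IHl ?IHr ?addnS.
Qed.

Definition ntree (n : nat) := {t : tree | nleaves t == n}.

Lemma nattach_subproof n (t : ntree n) (i : 'I_n) :
  nleaves (attach (val t) i) == n.+1.
Proof. by rewrite nleaves_attach (eqP (valP t)). Qed.

Definition nattach n (t : ntree n) (i : 'I_n) : ntree n.+1 :=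
  exist _ (attach (val t) i) (nattach_subproof t i).

(** After a caret is attached to leaf [i], its leaves are [i] and [i.+1]: the
    right one is [right_child i], and the map [lift (right_child i)], which
    skips it, sends [i] to the left one and every other old leaf to itself. *)
Definition right_child n (i : 'I_n) : 'I_n.+1 := lift ord0 i.
Definition old_leaf n (i j : 'I_n) : 'I_n.+1 := lift (right_child i) j.

Lemma right_childE n (i : 'I_n) : right_child i = i.+1 :> nat.
Proof. by []. Qed.

Lemma old_leafE n (i j : 'I_n) : old_leaf i j = (j + (i < j))%N :> nat.
Proof. by rewrite /old_leaf /= /bump /= addnC. Qed.

(** The bijection of leaves induced by [s] when carets are attached to [i] and
    [s i]: it sends [right_child i] to [right_child (s i)] and [old_leaf i j] to
    [old_leaf (s i) (s j)] for all [j]. *)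
Definition perm_expand n (i : 'I_n) (s : 'S_n) : 'S_n.+1 :=
  lift_perm (right_child i) (right_child (s i)) s.

Lemma perm_expand_right n (i : 'I_n) (s : 'S_n) :
  perm_expand i s (right_child i) = right_child (s i).
Proof. exact: lift_perm_id. Qed.

Lemma perm_expand_old n (i j : 'I_n) (s : 'S_n) :
  perm_expand i s (old_leaf i j) = old_leaf (s i) (s j).
Proof. exact: lift_perm_lift. Qed.

Section TreeOrder.
Local Open Scope nat_scope.

Fixpoint tle (t u : tree) : bool :=
  match t, u with
  | Leaf, _ => true
  | Node l r, Node l' r' => tle l l' && tle r r'
  | Node _ _, Leaf => false
  end.

Fixpoint tjoin (t u : tree) : tree :=
  match t, u with
  | Leaf, _ => u
  | _, Leaf => t
  | Node l r, Node l' r' => Node (tjoin l l') (tjoin r r')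
  end.

Lemma tle_refl t : tle t t.
Proof. by elim: t => //= l -> r ->. Qed.

Lemma tle_trans u t v : tle t u -> tle u v -> tle t v.
Proof.
elim: u t v => [|l IHl r IHr] [|tl tr] [|vl vr] //= /andP[tl_ul tr_ur] /andP[ul_vl ur_vr].
by rewrite (IHl _ _ tl_ul ul_vl) (IHr _ _ tr_ur ur_vr).
Qed.

Lemma tle_attach t i : tle t (attach t i).
Proof.
by elim: t i => //= l IHl r IHr i; case: ifP => _ /=; rewrite ?IHl ?IHr ?tle_refl.
Qed.

Lemma tle_joinl t u : tle t (tjoin t u).
Proof. by elim: t u => //= l IHl r IHr [|ul ur] /=; rewrite ?IHl ?IHr ?tle_refl. Qed.

Lemma tle_joinr t u : tle u (tjoin t u).
Proof. by elim: t u => [|l IHl r IHr] [|ul ur] //=; rewrite ?IHl ?IHr ?tle_refl. Qed.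

Lemma tle_nleaves t u : tle t u -> nleaves t <= nleaves u.
Proof.
elim: t u => [|l IHl r IHr] [|ul ur] //=.
  by move=> _; rewrite addn_gt0 nleaves_gt0.
by case/andP=> /IHl ? /IHr ?; rewrite leq_add.
Qed.

Lemma tle_step t u : tle t u -> t <> u ->
  exists2 i, i < nleaves t & tle (attach t i) u.
Proof.
elim: t u => [|l IHl r IHr] [|ul ur] //=; first by exists 0.
move=> /andP[lel ler] ne.
have [el|nel] := EM (l = ul); last first.
  have [i lti lei] := IHl _ lel nel; exists i; last by rewrite lti /= lei.
  exact: leq_trans lti (leq_addr _ _).
have ner : r <> ur by move=> er; apply: ne; rewrite el er.
have [i lti lei] := IHr _ ler ner; exists (nleaves l + i); first by rewrite ltn_add2l.
by rewrite ltnNge leq_addr /= addKn lel.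
Qed.

Lemma attachC t i j : i < nleaves t -> j < nleaves t -> i <> j ->
  attach (attach t i) (j + (i < j)) = attach (attach t j) (i + (j < i)).
Proof.
elim: t i j => [|l IHl r IHr] i j /=; first by case: i; case: j.
move=> lti ltj ne.
case: (ltnP i (nleaves l)) => hi; case: (ltnP j (nleaves l)) => hj /=;
  rewrite ?nleaves_attach.
- have -> : j + (i < j) < (nleaves l).+1 by lia.
  have -> : i + (j < i) < (nleaves l).+1 by lia.
  by rewrite IHl.
- have -> : j + (i < j) < (nleaves l).+1 = false by lia.
  have -> : i + (j < i) < nleaves l by lia.
  by congr Node; congr attach; lia.
- have -> : j + (i < j) < nleaves l by lia.
  have -> : i + (j < i) < (nleaves l).+1 = false by lia.
  by congr Node; congr attach; lia.
have -> : j + (i < j) < nleaves l = false by lia.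
have -> : i + (j < i) < nleaves l = false by lia.
congr Node.
have := IHr (i - nleaves l) (j - nleaves l) _ _ _.
have -> : j + (i < j) - nleaves l
          = j - nleaves l + (i - nleaves l < j - nleaves l) by lia.
have -> : i + (j < i) - nleaves l
          = i - nleaves l + (j - nleaves l < i - nleaves l) by lia.
by apply; lia.
Qed.

Lemma tle_attach2 t u i j : i < nleaves t -> j < nleaves t -> i <> j ->
  tle (attach t i) u -> tle (attach t j) u ->
  tle (attach (attach t i) (j + (i < j))) u.
Proof.
elim: t u i j => [|l IHl r IHr] u i j /=; first by case: i; case: j.
move=> lti ltj ne.
case: (ltnP i (nleaves l)) => hi; case: (ltnP j (nleaves l)) => hj /=;
  rewrite ?nleaves_attach; case: u => [|ul ur] //= /andP[a1 a2] /andP[b1 b2].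
- have -> : j + (i < j) < (nleaves l).+1 by lia.
  by rewrite /= a2 IHl.
- have -> : j + (i < j) < (nleaves l).+1 = false by lia.
  have -> : j + (i < j) - (nleaves l).+1 = j - nleaves l by lia.
  by rewrite /= a1.
- have -> : j + (i < j) < nleaves l by lia.
  have -> : j + (i < j) = j by lia.
  by rewrite /= a2 b1.
have -> : j + (i < j) < nleaves l = false by lia.
have -> : j + (i < j) - nleaves l
          = j - nleaves l + (i - nleaves l < j - nleaves l) by lia.
by rewrite /= a1 IHr //; lia.
Qed.

End TreeOrder.

(** The constructions of [V] (tree pairs labelled by ['S_n]) and of [CV]
    (labelled by [J_n]) are the same. They only use the homomorphism [csperm] to
    ['S_n] (the identity for [V], [pi_n] for [CV]) and the map [csexpand i],
    which sends the label [s] of a pair to the label [s'] of its expansion at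
    leaf [i] of the positive tree. *)
Record cloning_system := CloningSystem {
  csgroup :> nat -> groupType;
  csperm : forall n, csgroup n -> 'S_n;
  csexpand : forall n, 'I_n -> csgroup n -> csgroup n.+1;
  cspermM : forall n (s t : csgroup n), csperm (s * t) = csperm s * csperm t;
  csexpandM : forall n (i : 'I_n) (s t : csgroup n),
    csexpand i (s * t) = csexpand i s * csexpand (csperm s i) t;
  csperm_expand : forall n (i : 'I_n) (s : csgroup n),
    csperm (csexpand i s) = perm_expand i (csperm s);
  csexpandC : forall n (i j : 'I_n) (s : csgroup n), i != j ->
    csexpand (old_leaf i j) (csexpand i s) =
    csexpand (old_leaf j i) (csexpand j s)
}.

Section TreePairs.
Variable K : cloning_system.

Definition pair_at (n : nat) : Type := (ntree n * K n * ntree n)%type.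

Definition tree_pair : Type := {n : nat & pair_at n}.

Definition tpair n (p : ntree n) (s : K n) (m : ntree n) : tree_pair :=
  existT pair_at n (p, s, m).

HB.instance Definition _ := gen_eqMixin tree_pair.
HB.instance Definition _ := gen_choiceMixin tree_pair.

Inductive expansion : tree_pair -> tree_pair -> Prop :=
  Expansion n (p : ntree n) (s : K n) (m : ntree n) (i : 'I_n) :
    expansion (tpair p s m)
      (tpair (nattach p i) (csexpand i s) (nattach m (csperm s i))).

Definition pair_equiv : tree_pair -> tree_pair -> Prop :=
  clos_refl_sym_trans _ expansion.

Definition pair_equivb (x y : tree_pair) : bool := `[< pair_equiv x y >].

Lemma pair_equivb_refl : reflexive pair_equivb.
Proof. by move=> x; apply/asboolP/rst_refl. Qed.

Lemma pair_equivb_sym : symmetric pair_equivb.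
Proof. by move=> x y; apply/asboolP/asboolP; apply: rst_sym. Qed.

Lemma pair_equivb_trans : transitive pair_equivb.
Proof.
by move=> y x z /asboolP xy /asboolP yz; apply/asboolP; apply: rst_trans xy yz.
Qed.

Canonical pair_equiv_rel :=
  EquivRel pair_equivb pair_equivb_refl pair_equivb_sym pair_equivb_trans.

Definition thompson : Type := {eq_quot pair_equiv_rel}.

HB.instance Definition _ := Quotient.on thompson.
HB.instance Definition _ := Choice.on thompson.

Definition pair_class (x : tree_pair) : thompson := (\pi x)%qT.

Lemma pair_classP x y : pair_class x = pair_class y <-> pair_equiv x y.
Proof.
split; last by move=> e; apply/eqmodP/asboolP.
by move/eqmodP/asboolP.
Qed.

Lemma pair_class_surj g : exists x, g = pair_class x.
Proof. by exists (repr g); rewrite /pair_class reprK. Qed.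

(** [pair_mul x y z]: [x] and [y] are composable with product [z]. *)
Inductive pair_mul : tree_pair -> tree_pair -> tree_pair -> Prop :=
  PairMul n (p q m : ntree n) (s t : K n) :
    pair_mul (tpair p s q) (tpair q t m) (tpair p (s * t) m).

Definition is_product (g h k : thompson) : Prop :=
  exists x y z, [/\ pair_mul x y z, g = pair_class x, h = pair_class y
    & k = pair_class z].

Definition pair_inv (x : tree_pair) : tree_pair :=
  let: existT n (p, s, m) := x in tpair m s^-1 p.

End TreePairs.

Section TreePairGroup.
Variable K : cloning_system.

Local Notation star := (clos_refl_trans (tree_pair K) (@expansion K)).

Definition lnleaves (x : tree_pair K) : nat := tag x.
Definition ltree (x : tree_pair K) : tree := val (tagged x).1.1.
Definition rtree (x : tree_pair K) : tree := val (tagged x).2.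

Lemma tpair_inj n (p p' : ntree n) (s s' : K n) (m m' : ntree n) :
  tpair p s m = tpair p' s' m' -> [/\ p = p', s = s' & m = m'].
Proof.
move=> e.
by case: (Eqdep_dec.inj_pair2_eq_dec _ PeanoNat.Nat.eq_dec (pair_at K) n _ _ e).
Qed.

Lemma csperm1 n : csperm (1 : K n) = 1.
Proof.
have := cspermM (1 : K n) 1; rewrite mul1g => e.
by apply: (mulgI (csperm (1 : K n))); rewrite -e mulg1.
Qed.

Lemma cspermV n (s : K n) : csperm s^-1 = (csperm s)^-1.
Proof.
by apply: (mulgI (csperm s)); rewrite -cspermM !mulgV csperm1.
Qed.

Lemma csexpand1 n (i : 'I_n) : csexpand i (1 : K n) = 1.
Proof.
have := csexpandM i (1 : K n) 1; rewrite mul1g csperm1 perm1 => e.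
by apply: (mulgI (csexpand i (1 : K n))); rewrite -e mulg1.
Qed.

Lemma csexpandV n (i : 'I_n) (s : K n) :
  csexpand (csperm s i) s^-1 = (csexpand i s)^-1.
Proof.
by apply: (mulgI (csexpand i s)); rewrite -csexpandM !mulgV csexpand1.
Qed.

Lemma nattachC n (t : ntree n) (i j : 'I_n) : i != j ->
  nattach (nattach t i) (old_leaf i j) = nattach (nattach t j) (old_leaf j i).
Proof.
move=> ne; apply: val_inj; rewrite /= -/(old_leaf i j).
have e (a b : 'I_n) : bump (bump 0 a) b = (b + (a < b))%N.
  by rewrite /bump /= addnC.
have tn := eqP (valP t).
by rewrite !e attachC ?tn //; move/val_inj/eqP; apply/negP.
Qed.

Lemma expansion_inv (x y : tree_pair K) : expansion x y -> expansion (pair_inv x) (pair_inv y).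
Proof.
case=> n p s m i /=; rewrite -csexpandV.
have := Expansion m s^-1 p (csperm s i).
by rewrite cspermV permK.
Qed.

Lemma pair_invK : involutive (@pair_inv K).
Proof. by case=> n [[p s] m]; rewrite /pair_inv /= invgK. Qed.

Lemma star_inv (x y : tree_pair K) : star x y -> star (pair_inv x) (pair_inv y).
Proof.
elim=> [{}x {}y /expansion_inv|{}x|{}x {}y z _ h1 _ h2].
- exact: rt_step.
- exact: rt_refl.
exact: rt_trans h1 h2.
Qed.

Lemma ltree_inv (x : tree_pair K) : ltree (pair_inv x) = rtree x.
Proof. by case: x => n [[p s] m]. Qed.

Lemma rtree_inv (x : tree_pair K) : rtree (pair_inv x) = ltree x.
Proof. by case: x => n [[p s] m]. Qed.

Lemma nleaves_ltree (x : tree_pair K) : nleaves (ltree x) = tag x.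
Proof. by case: x => n [[[p /= hp] s] m]; apply/eqP. Qed.

Lemma nleaves_rtree (x : tree_pair K) : nleaves (rtree x) = tag x.
Proof. by case: x => n [[p s] [m /= hm]]; apply/eqP. Qed.

Lemma expansion_tle (x y : tree_pair K) : expansion x y -> tle (ltree x) (ltree y).
Proof. by case=> n p s m i; apply: tle_attach. Qed.

Lemma star_tle x y : star x y -> tle (ltree x) (ltree y).
Proof.
elim=> [{}x {}y /expansion_tle //|{}x|{}x {}y z _ h1 _ h2].
  exact: tle_refl.
exact: tle_trans h1 h2.
Qed.

Lemma star_reach x u : tle (ltree x) u -> exists2 y, star x y & ltree y = u.
Proof.
have [k] := ubnP (nleaves u - nleaves (ltree x)).
elim: k x => // k IHk x lek leu.
have [e|ne] := EM (ltree x = u); first by exists x => //; apply: rt_refl.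
have [i lti lei] := tle_step leu ne.
case: x => n [[p s] m] in lek leu ne lti lei *.
rewrite nleaves_ltree /= in lti.
have st := Expansion p s m (Ordinal lti).
have [] := IHk (tpair (nattach p (Ordinal lti)) (csexpand (Ordinal lti) s)
                      (nattach m (csperm s (Ordinal lti)))) _ lei.
  rewrite nleaves_ltree /=; rewrite nleaves_ltree /= in lek.
  by have := tle_nleaves lei; rewrite nleaves_attach (eqP (valP p)); lia.
move=> y sty ey; exists y => //; apply: rt_trans sty; exact: rt_step.
Qed.

Lemma star1n x y : star x y -> x = y \/ exists2 z, expansion x z & star z y.
Proof. 
move=> st; have h := clos_rt_rt1n _ _ _ _ st.
case: h => [|z w xz zy]; [by left | right; exists z => //].
exact: clos_rt1n_rt. Qed.

Lemma expansion_tag (x y : tree_pair K) : expansion x y -> tag y = (tag x).+1.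
Proof. by case. Qed.

Lemma star_tag x y : star x y -> tag x <= tag y.
Proof.
by move/star_tle/tle_nleaves; rewrite !nleaves_ltree.
Qed.

Lemma star_det x y z : star x y -> star x z -> ltree y = ltree z -> y = z.
Proof.
have [k] := ubnP (tag y - tag x).
elim: k x y z => // k IHk x y z lek xy xz eyz.
have tyz : tag y = tag z by rewrite -!nleaves_ltree eyz.
case/star1n: (xy) => [e|[y1 xy1 y1y]].
  case/star1n: (xz) => [<-//|[z1 /expansion_tag xz1 /star_tag z1z]].
  by subst y; lia.
case/star1n: (xz) => [e|[z1 xz1 z1z]].
  by have := expansion_tag xy1; have := star_tag y1y; subst z; lia.
have ty1 := star_tag y1y; have ety1 := expansion_tag xy1.
have tz1 := star_tag z1z; have etz1 := expansion_tag xz1.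
case: xy1 ety1 y1y ty1 xz1 lek xy xz => n p s m i _ y1y ty1.
have [x0 ex] : {x0 | x0 = tpair p s m} by exists (tpair p s m).
rewrite -ex => xz1; move: ex.
case: xz1 z1z tz1 etz1 => n' p' s' m' j z1z tz1 etz1 ex.
have en : n' = n by case: ex.
subst n'; case/tpair_inj: ex => ? ? ?; subst p' s' m' => lek xy xz.
have [eij|ne] := eqVneq i j.
  by subst j; apply: IHk y1y z1z eyz; rewrite /= in lek ty1 *; lia.
have nei : val i <> val j by move/val_inj/eqP; apply/negP.
have sy := Expansion (nattach p i) (csexpand i s) (nattach m (csperm s i)) (old_leaf i j).
have sz := Expansion (nattach p j) (csexpand j s) (nattach m (csperm s j)) (old_leaf j i).
have nes : csperm s i != csperm s j by rewrite (inj_eq perm_inj).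
move: sy sz; rewrite !csperm_expand !perm_expand_old (nattachC p ne).
rewrite (nattachC m nes) (csexpandC s ne).
set w := tpair (nattach (nattach p j) (old_leaf j i)) _ _ => yw zw.
have lew : tle (ltree w) (ltree y).
  rewrite /w -(nattachC p ne) /ltree /=.
  have -> : bump (bump 0 i) j = (j + (i < j))%N by rewrite /bump /= addnC.
  apply: tle_attach2; rewrite ?(eqP (valP p)) //.
    exact: (star_tle y1y).
  by have := star_tle z1z; rewrite -eyz.
have [v wv ev] := star_reach lew.
transitivity v.
  apply: IHk y1y (rt_trans _ _ _ _ _ (rt_step _ _ _ _ yw) wv) _ => //.
  by rewrite /= in lek ty1 *; lia.
apply/esym; apply: IHk z1z (rt_trans _ _ _ _ _ (rt_step _ _ _ _ zw) wv) _.
  by rewrite /= in lek ty1 *; lia.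
by rewrite -eyz.
Qed.

Lemma star_det_r (x y z : tree_pair K) : star x y -> star x z -> rtree y = rtree z -> y = z.
Proof.
move=> /star_inv xy /star_inv xz e; apply: (can_inj pair_invK).
by apply: star_det xy xz _; rewrite !ltree_inv.
Qed.

Lemma star_reach_r x u : tle (rtree x) u -> exists2 y, star x y & rtree y = u.
Proof.
rewrite -ltree_inv => /star_reach[y /star_inv]; rewrite pair_invK => xy ey.
by exists (pair_inv y); rewrite ?rtree_inv.
Qed.

Lemma star_equiv (x y : tree_pair K) : star x y -> pair_equiv x y.
Proof. exact: clos_rt_clos_rst. Qed.

Lemma pair_equiv_join (x y : tree_pair K) :
  pair_equiv x y <-> exists2 z, star x z & star y z.
Proof.
split; last first.
  move=> [z /star_equiv xz /star_equiv yz].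
  exact: rst_trans xz (rst_sym _ _ _ _ yz).
elim=> [{}x {}y xy|{}x|{}x {}y _ [z xz yz]|{}x {}y z _ [v xv yv] _ [w yw zw]].
- by exists y; [apply: rt_step|apply: rt_refl].
- by exists x; apply: rt_refl.
- by exists z.
have [v' vv' ev] := star_reach (tle_joinl (ltree v) (ltree w)).
have [w' ww' ew] := star_reach (tle_joinr (ltree v) (ltree w)).
have yv' := rt_trans _ _ _ _ _ yv vv'; have yw' := rt_trans _ _ _ _ _ yw ww'.
have e := star_det yv' yw' (etrans ev (esym ew)); subst w'.
exists v'; [exact: rt_trans xv vv' | exact: rt_trans zw ww'].
Qed.

Lemma pair_mul_inv (x y z : tree_pair K) : pair_mul x y z ->
  pair_mul (pair_inv y) (pair_inv x) (pair_inv z).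
Proof. by case=> n p q m s t /=; rewrite invgM; constructor. Qed.

Lemma pair_mul_fun (x y z z' : tree_pair K) : pair_mul x y z -> pair_mul x y z' -> z = z'.
Proof.
case=> n p q m s t; have [x' ex] : {x | x = tpair p s q} by eexists.
have [y' ey] : {x | x = tpair q t m} by eexists.
rewrite -ex -ey => h; case: h ex ey => n' p' q' m' s' t' ex.
have en : n' = n by case: ex.
subst n'; case/tpair_inj: ex => ? ? ?; subst p' s' q'.
by case/tpair_inj => _ -> ->.
Qed.

Lemma pair_mul_step (x y z x' : tree_pair K) : pair_mul x y z -> expansion x x' ->
  exists y' z', [/\ pair_mul x' y' z', expansion y y' & expansion z z'].
Proof.
case=> n p q m s t; have [x0 ex] : {x | x = tpair p s q} by eexists.
rewrite -ex => h; case: h ex => n' p' s' m' i ex.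
have en : n' = n by case: ex.
subst n'; case/tpair_inj: ex => ? ? ?; subst p' s' m'.
exists (tpair (nattach q (csperm s i)) (csexpand (csperm s i) t)
   (nattach m (csperm t (csperm s i)))).
exists (tpair (nattach p i) (csexpand i (s * t)) (nattach m (csperm (s * t) i))).
split; try by constructor.
by rewrite csexpandM cspermM permM; constructor.
Qed.

Lemma pair_mul_star x y z x' : pair_mul x y z -> star x x' ->
  exists y' z', [/\ pair_mul x' y' z', star y y' & star z z'].
Proof.
move=> h xx'; elim: xx' y z h => [{}x {}x' st|{}x|{}x u v _ IH1 _ IH2] y z h.
- have [y' [z' [? ? ?]]] := pair_mul_step h st.
  by exists y', z'; split=> //; apply: rt_step.
- by exists y, z; split=> //; apply: rt_refl.
have [y' [z' [h' yy' zz']]] := IH1 _ _ h.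
have [y2 [z2 [h2 yy2 zz2]]] := IH2 _ _ h'.
exists y2, z2; split=> //; [exact: rt_trans yy' yy2|exact: rt_trans zz' zz2].
Qed.

Lemma pair_mul_star_r x y z y' : pair_mul x y z -> star y y' ->
  exists x' z', [/\ pair_mul x' y' z', star x x' & star z z'].
Proof.
move=> /pair_mul_inv h /star_inv st.
have [u [v [/pair_mul_inv h' /star_inv xu /star_inv zv]]] := pair_mul_star h st.
by move: h' xu zv; rewrite !pair_invK => *; exists (pair_inv u), (pair_inv v).
Qed.

Lemma pair_mul_mid (x y z : tree_pair K) : pair_mul x y z -> rtree x = ltree y.
Proof. by case. Qed.

Lemma pair_mul_ex (x y : tree_pair K) : rtree x = ltree y -> exists z, pair_mul x y z.
Proof.
case: x => n [[p s] q]; case: y => n' [[q' t] m] e.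
have en : n = n'.
  by move: (nleaves_rtree (tpair p s q)); rewrite e nleaves_ltree.
subst n'; have eq : q = q' by apply: val_inj.
by subst q'; exists (tpair p (s * t) m); constructor.
Qed.

Lemma pair_mul_common (x y : tree_pair K) : exists x' y' z',
  [/\ pair_mul x' y' z', star x x' & star y y'].
Proof.
have [x' xx' ex] := star_reach_r (tle_joinl (rtree x) (ltree y)).
have [y' yy' ey] := star_reach (tle_joinr (rtree x) (ltree y)).
have [z h] := pair_mul_ex (etrans ex (esym ey)).
by exists x', y', z.
Qed.

Lemma pair_mul_equiv (x y z x' y' z' : tree_pair K) : pair_mul x y z -> pair_mul x' y' z' ->
  pair_equiv x x' -> pair_equiv y y' -> pair_equiv z z'.
Proof.
move=> h h' /pair_equiv_join[x2 xx2 x'x2] yy'.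
have [y1 [z1 [h1 yy1 zz1]]] := pair_mul_star h xx2.
have [y2 [z2 [h2 yy2 zz2]]] := pair_mul_star h' x'x2.
have /pair_equiv_join[y3 y13 y23] : pair_equiv y1 y2.
  apply: rst_trans (star_equiv yy2); apply: rst_trans yy'.
  exact: rst_sym (star_equiv yy1).
have [x3 [z3 [h3 xx3 zz3]]] := pair_mul_star_r h1 y13.
have [x4 [z4 [h4 xx4 zz4]]] := pair_mul_star_r h2 y23.
have e : x3 = x4.
  by apply: star_det_r xx3 xx4 _; rewrite (pair_mul_mid h3) (pair_mul_mid h4).
subst x4; have e := pair_mul_fun h3 h4; subst z4.
apply/pair_equiv_join; exists z3; first exact: rt_trans zz1 zz3.
exact: rt_trans zz2 zz4.
Qed.

Local Notation tgroup := (thompson K).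

Lemma pair_class_star x y : star x y -> pair_class x = pair_class y.
Proof. by move/star_equiv => /pair_classP. Qed.

Lemma is_product_ex (g h : tgroup) : exists k, is_product g h k.
Proof.
have [x ->] := pair_class_surj g; have [y ->] := pair_class_surj h.
have [x' [y' [z' [h' xx' yy']]]] := pair_mul_common x y.
exists (pair_class z'), x', y', z'; split=> //; exact: pair_class_star.
Qed.

Lemma is_product_fun (g h k k' : tgroup) :
  is_product g h k -> is_product g h k' -> k = k'.
Proof.
move=> [x [y [z [m -> -> ->]]]] [x' [y' [z' [m' /pair_classP ex /pair_classP ey ->]]]].
by apply/pair_classP; apply: pair_mul_equiv m m' ex ey.
Qed.

(** The product of two classes, computed on any composable representatives:
    see [tmulE]. *)
Definition tmul (g h : tgroup) : tgroup := sval (cid (is_product_ex g h)).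

Lemma tmulP (g h : tgroup) : is_product g h (tmul g h).
Proof. exact: (svalP (cid (is_product_ex g h))). Qed.

Lemma tmulE x y z : pair_mul x y z ->
  tmul (pair_class x) (pair_class y) = pair_class z.
Proof. by move=> h; apply: is_product_fun (tmulP _ _) _; exists x, y, z. Qed.

Definition leaf1 : ntree 1%N := exist _ Leaf (eqxx 1%N).

Definition tone : tgroup :=
  pair_class (tpair leaf1 (1 : K 1%N) leaf1).

Definition pair_id (x : tree_pair K) := exists n (t : ntree n), x = tpair t 1 t.

Lemma pair_id_star (x y : tree_pair K) : pair_id x -> star x y -> pair_id y.
Proof.
move=> ix xy; elim: xy ix => [{}x {}y|//|{}x {}y z _ IH1 _ IH2 /IH1 /IH2 //].
case=> n p s m i [n' [t ex]].
have en : n' = n by case: ex.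
subst n'; case/tpair_inj: ex => ? ? ?; subst p s m.
by exists n.+1, (nattach t i); rewrite csexpand1 csperm1 perm1.
Qed.

Lemma toneE n (t : ntree n) : pair_class (tpair t 1 t) = tone.
Proof.
rewrite /tone; set x := tpair leaf1 1 leaf1.
have [|y xy ey] := @star_reach x (val t).
  by rewrite /x /ltree /=; case: (val t).
have [n' [t' e]] : pair_id y by apply: pair_id_star xy; exists 1%N; eexists.
rewrite (pair_class_star xy) e; subst y.
have en : n' = n by rewrite -(eqP (valP t)) -ey (eqP (valP t')).
by subst n'; congr (pair_class (tpair _ _ _)); apply: val_inj.
Qed.

Definition tinv (g : tgroup) : tgroup := pair_class (pair_inv (repr g)).

Lemma tinvE x : tinv (pair_class x) = pair_class (pair_inv x).
Proof.
apply/pair_classP/pair_equiv_join.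
have /pair_classP/pair_equiv_join[z /star_inv ? /star_inv ?] :
  pair_class (repr (pair_class x)) = pair_class x by rewrite /pair_class reprK.
by exists (pair_inv z).
Qed.

Lemma tmulA : associative tmul.
Proof.
move=> g h k; have [x ->] := pair_class_surj g.
have [y ->] := pair_class_surj h; have [w ->] := pair_class_surj k.
have [x1 [y1 [z1 [m1 xx1 yy1]]]] := pair_mul_common x y.
have [y2 [w2 [v2 [m2 yy2 ww2]]]] := pair_mul_common y1 w.
have [x2 [z2 [m3 xx2 zz2]]] := pair_mul_star_r m1 yy2.
rewrite (pair_class_star xx1) (pair_class_star xx2) (pair_class_star ww2).
rewrite (pair_class_star yy1) (pair_class_star yy2).
rewrite (tmulE m2) (tmulE m3).
case: m3 m2 {xx1 yy1 yy2 zz2 m1 xx2} => n p q m s t m2.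
have [q2 [u ew ev]] : exists q2, exists2 u : K n, w2 = tpair m u q2 & v2 = tpair q (t * u) q2.
  have [y0 ey] : {y0 | y0 = tpair q t m} by eexists.
  rewrite -ey in m2; case: m2 ey {ww2} => n' p' q' m' s' t' ey.
  have en : n' = n by case: ey.
  subst n'; case/tpair_inj: ey => ? ? ?; subst p' s' q'.
  by exists m', t'.
subst w2 v2; rewrite (tmulE (PairMul _ _ _ _ _)) (tmulE (PairMul _ _ _ _ _)).
by rewrite mulgA.
Qed.

Lemma tmul1g : left_id tone tmul.
Proof.
move=> g; have [x ->] := pair_class_surj g; case: x => n [[p s] m].
by rewrite -(toneE p) (tmulE (PairMul _ _ _ _ _)) mul1g.
Qed.

Lemma tmulg1 : right_id tone tmul.
Proof.
move=> g; have [x ->] := pair_class_surj g; case: x => n [[p s] m].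
by rewrite -(toneE m) (tmulE (PairMul _ _ _ _ _)) mulg1.
Qed.

Lemma tmulVg : left_inverse tone tinv tmul.
Proof.
move=> g; have [x ->] := pair_class_surj g; case: x => n [[p s] m].
by rewrite tinvE (tmulE (PairMul _ _ _ _ _)) mulVg toneE.
Qed.

Lemma tmulgV : right_inverse tone tinv tmul.
Proof.
move=> g; have [x ->] := pair_class_surj g; case: x => n [[p s] m].
by rewrite tinvE (tmulE (PairMul _ _ _ _ _)) mulgV toneE.
Qed.

HB.instance Definition _ :=
  isGroup.Build (thompson K) tmulA tmul1g tmulg1 tmulVg tmulgV.

End TreePairGroup.

(** The letter [(i, j)] stands for the generator [s_(i,j)] of [J_n], with
    [0 <= i < j < n]. *)
Definition letter (n : nat) := {ij : nat * nat | (ij.1 < ij.2 < n)%N}.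

Definition word (n : nat) := seq (letter n).

Section Words.
Variable n : nat.
Implicit Types a b c : letter n.

Definition lo a : nat := (val a).1.
Definition hi a : nat := (val a).2.

Lemma lo_hi a : (lo a < hi a < n)%N.
Proof. exact: valP a. Qed.

Definition flip (i j m : nat) : nat := if (i <= m <= j)%N then (i + j - m)%N else m.

Lemma flip_subproof a (m : 'I_n) : (flip (lo a) (hi a) m < n)%N.
Proof. by have := lo_hi a; have := ltn_ord m; rewrite /flip; case: ifP; lia. Qed.

Definition letter_fun a (m : 'I_n) : 'I_n := Ordinal (flip_subproof a m).

Lemma letter_funK a : involutive (letter_fun a).
Proof.
move=> m; apply: ord_inj; have := lo_hi a; rewrite /= /flip.
by case: (boolP (lo a <= m <= hi a)%N) => h1; case: ifP; lia.
Qed.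

Definition letter_perm a : 'S_n := perm (can_inj (letter_funK a)).

Definition word_perm (w : word n) : 'S_n := \prod_(a <- w) letter_perm a.

Inductive cactus_relator : word n -> word n -> Prop :=
| RelInvolution a : cactus_relator [:: a; a] [::]
| RelDisjoint a b : (hi a < lo b)%N -> cactus_relator [:: a; b] [:: b; a]
| RelNested a b c : (lo a <= lo b)%N -> (hi b <= hi a)%N ->
    lo c = (lo a + hi a - hi b)%N -> hi c = (lo a + hi a - lo b)%N ->
    cactus_relator [:: a; b] [:: c; a].

Inductive cactus_step : word n -> word n -> Prop :=
  CactusStep u v l r : cactus_relator l r ->
    cactus_step (u ++ l ++ v) (u ++ r ++ v).

(** Since the generators are involutions, every element is represented by a
    positive word: [J_n] is the monoid with the same presentation. *)
Definition word_equiv : word n -> word n -> Prop :=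
  clos_refl_sym_trans _ cactus_step.

Definition word_equivb (u v : word n) : bool := `[< word_equiv u v >].

Lemma word_equivb_refl : reflexive word_equivb.
Proof. by move=> x; apply/asboolP/rst_refl. Qed.

Lemma word_equivb_sym : symmetric word_equivb.
Proof. by move=> x y; apply/asboolP/asboolP; apply: rst_sym. Qed.

Lemma word_equivb_trans : transitive word_equivb.
Proof.
by move=> y x z /asboolP xy /asboolP yz; apply/asboolP; apply: rst_trans xy yz.
Qed.

Canonical word_equiv_rel :=
  EquivRel word_equivb word_equivb_refl word_equivb_sym word_equivb_trans.

Definition cactus : Type := {eq_quot word_equiv_rel}.

HB.instance Definition _ := Quotient.on cactus.
HB.instance Definition _ := Choice.on cactus.

Definition word_class (w : word n) : cactus := \pi w.

Lemma word_classP u v : word_class u = word_class v <-> word_equiv u v.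
Proof.
split; last by move=> e; apply/eqmodP/asboolP.
by move/eqmodP/asboolP.
Qed.

Lemma word_class_surj s : exists w, s = word_class w.
Proof. by exists (repr s); rewrite /word_class reprK. Qed.

Lemma word_equiv_repr w : word_equiv (repr (word_class w)) w.
Proof. by apply/word_classP; rewrite /word_class reprK. Qed.

Lemma word_equiv_ind (T : Type) (f : word n -> T) :
  (forall u v l r, cactus_relator l r -> f (u ++ l ++ v) = f (u ++ r ++ v)) ->
  forall u v, word_equiv u v -> f u = f v.
Proof.
move=> fE u v; elim=> {u v} [_ _ [u v l r lr]|//|u v _ -> //|u v w _ -> _ -> //].
exact: fE.
Qed.

Lemma word_equiv_cat u u' v v' :
  word_equiv u u' -> word_equiv v v' -> word_equiv (u ++ v) (u' ++ v').
Proof.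
move=> /word_classP uu' /word_classP vv'; apply/word_classP.
transitivity (word_class (u ++ v')).
  apply: (word_equiv_ind (f := fun w => word_class (u ++ w))) => [a b l r lr|].
    by apply/word_classP/rst_step; rewrite !(catA u); constructor.
  exact/word_classP.
apply: (word_equiv_ind (f := fun w => word_class (w ++ v'))) => [a b l r lr|].
  by apply/word_classP/rst_step; rewrite -!catA; constructor.
exact/word_classP.
Qed.

Definition cactus_one : cactus := word_class [::].
Definition cactus_mul (s t : cactus) : cactus := word_class (repr s ++ repr t).
Definition cactus_inv (s : cactus) : cactus := word_class (rev (repr s)).

Lemma cactus_mulE u v :
  cactus_mul (word_class u) (word_class v) = word_class (u ++ v).
Proof. by apply/word_classP/word_equiv_cat; apply: word_equiv_repr. Qed.

Lemma cactus_mulA : associative cactus_mul.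
Proof.
move=> s t r; have [u ->] := word_class_surj s; have [v ->] := word_class_surj t.
by have [w ->] := word_class_surj r; rewrite !cactus_mulE catA.
Qed.

Lemma cactus_mul1g : left_id cactus_one cactus_mul.
Proof. by move=> s; have [u ->] := word_class_surj s; rewrite cactus_mulE. Qed.

Lemma cactus_mulg1 : right_id cactus_one cactus_mul.
Proof.
by move=> s; have [u ->] := word_class_surj s; rewrite cactus_mulE cats0.
Qed.

Lemma cactus_cat_rev w : word_class (w ++ rev w) = cactus_one.
Proof.
elim: w => [|a w IH] //; rewrite rev_cons -cats1 cat_cons catA -cat1s.
rewrite -cactus_mulE -[word_class (_ ++ [:: a])]cactus_mulE IH cactus_mul1g.
rewrite cactus_mulE; apply/word_classP/rst_step.
exact: (CactusStep [::] [::] (RelInvolution a)).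
Qed.

Lemma cactus_mulgV : right_inverse cactus_one cactus_inv cactus_mul.
Proof.
move=> s; rewrite -{1}[s]reprK -/(word_class _) cactus_mulE.
exact: cactus_cat_rev.
Qed.

Lemma cactus_mulVg : left_inverse cactus_one cactus_inv cactus_mul.
Proof.
move=> s; rewrite -{2}[s]reprK -/(word_class _) cactus_mulE.
by rewrite -{2}[repr s]revK cactus_cat_rev.
Qed.

HB.instance Definition _ := isGroup.Build cactus
  cactus_mulA cactus_mul1g cactus_mulg1 cactus_mulVg cactus_mulgV.

Lemma word_class_cat u v : word_class (u ++ v) = word_class u * word_class v.
Proof. by rewrite -cactus_mulE. Qed.

Lemma word_perm_cat u v : word_perm (u ++ v) = word_perm u * word_perm v.
Proof. exact: big_cat. Qed.

Lemma letter_permE a (m : 'I_n) : letter_perm a m = flip (lo a) (hi a) m :> nat.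
Proof. by rewrite permE. Qed.

Lemma word_perm2 a b : word_perm [:: a; b] = letter_perm a * letter_perm b.
Proof. by rewrite /word_perm !big_cons big_nil mulg1. Qed.

Lemma relator_perm l r : cactus_relator l r -> word_perm l = word_perm r.
Proof.
case=> [a|a b h|a b c h1 h2 ec1 ec2]; rewrite ?word_perm2; apply/permP => m;
  apply: ord_inj.
- by rewrite /word_perm big_nil perm1 permM !permE letter_funK.
- have ha := lo_hi a; have hb := lo_hi b.
  by rewrite !permM !letter_permE /flip; repeat case: ifP; lia.
have ha := lo_hi a; have hb := lo_hi b.
by rewrite !permM !letter_permE ec1 ec2 /flip; repeat case: ifP; lia.
Qed.

(** This is [pi_n]; the value does not depend on the representing word
    ([cactus_permE]). *)
Definition cactus_perm (s : cactus) : 'S_n := word_perm (repr s).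

Lemma cactus_permE w : cactus_perm (word_class w) = word_perm w.
Proof.
apply: word_equiv_ind (word_equiv_repr w) => u v l r lr.
by rewrite !word_perm_cat (relator_perm lr).
Qed.

Lemma cactus_permM (s t : cactus) :
  cactus_perm (s * t) = cactus_perm s * cactus_perm t.
Proof.
have [u ->] := word_class_surj s; have [v ->] := word_class_surj t.
by rewrite -word_class_cat !cactus_permE word_perm_cat.
Qed.

End Words.

(** The one-letter word [s_(i,j)] when [i < j < n], the only case used; the
    empty word otherwise. *)
Definition gen_word (n i j : nat) : word n :=
  if insub (i, j) is Some a then [:: a] else [::].

Definition letter_expand n (p : 'I_n) (a : letter n) : word n.+1 :=
  if (hi a < p)%N then gen_word n.+1 (lo a) (hi a)
  else if (p < lo a)%N then gen_word n.+1 (lo a).+1 (hi a).+1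
  else gen_word n.+1 p p.+1 ++ gen_word n.+1 (lo a) (hi a).+1.

Fixpoint word_expand n (p : 'I_n) (w : word n) : word n.+1 :=
  if w is a :: w' then letter_expand p a ++ word_expand (letter_perm a p) w'
  else [::].

(** The label of the expansion; the value does not depend on the representing
    word ([cactus_expandE]). *)
Definition cactus_expand n (p : 'I_n) (s : cactus n) : cactus n.+1 :=
  word_class (word_expand p (repr s)).

Definition sgen (n i j : nat) : cactus n := word_class (gen_word n i j).

Section Generators.
Variable n : nat.
Implicit Types i j k l : nat.

Lemma gen_wordE i j (h : (i < j < n)%N) :
  gen_word n i j = [:: (exist _ (i, j) h : letter n)].
Proof.
rewrite /gen_word; case: insubP => [a _ e|/=]; last by rewrite h.
by congr [:: _]; apply: val_inj.
Qed.

Lemma relator_class u v : cactus_relator u v ->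
  word_class u = word_class v :> cactus n.
Proof.
move=> uv; apply/word_classP/rst_step.
by have := CactusStep [::] [::] uv; rewrite /= !cats0.
Qed.

Lemma sgen2 i j : sgen n i j * sgen n i j = 1.
Proof.
rewrite /sgen; have [h|/negPf h] := boolP (i < j < n)%N.
  rewrite (gen_wordE h) -word_class_cat; exact: relator_class (RelInvolution _).
by rewrite /gen_word insubF //= mulg1.
Qed.

Lemma sgenC i j k l : i < j -> j < k -> k < l -> l < n ->
  sgen n i j * sgen n k l = sgen n k l * sgen n i j.
Proof.
move=> ij jk kl ln.
have hij : (i < j < n)%N by lia.
have hkl : (k < l < n)%N by lia.
rewrite /sgen (gen_wordE hij) (gen_wordE hkl) -!word_class_cat.
exact/relator_class/RelDisjoint.
Qed.

Lemma sgenN i j k l k' l' : i <= k -> k < l -> l <= j -> j < n ->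
  k' = (i + j - l)%N -> l' = (i + j - k)%N ->
  sgen n i j * sgen n k l = sgen n k' l' * sgen n i j.
Proof.
move=> ik kl lj jn -> ->.
have hij : (i < j < n)%N by lia.
have hkl : (k < l < n)%N by lia.
have hc : (i + j - l < i + j - k < n)%N by lia.
rewrite /sgen (gen_wordE hij) (gen_wordE hkl) (gen_wordE hc) -!word_class_cat.
exact/relator_class/RelNested.
Qed.

End Generators.

Lemma word_expand_cat n (p : 'I_n) (u v : word n) :
  word_expand p (u ++ v) = word_expand p u ++ word_expand (word_perm u p) v.
Proof.
elim: u p => [|a u IH] p /=; first by rewrite /word_perm big_nil perm1.
by rewrite IH catA /word_perm big_cons permM.
Qed.

Lemma letter_expandE n (p : 'I_n) (a : letter n) :
  word_class (letter_expand p a) =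
    if (hi a < p)%N then sgen n.+1 (lo a) (hi a)
    else if (p < lo a)%N then sgen n.+1 (lo a).+1 (hi a).+1
    else sgen n.+1 p p.+1 * sgen n.+1 (lo a) (hi a).+1.
Proof.
by rewrite /letter_expand; case: ifP => // _; case: ifP => // _; rewrite word_class_cat.
Qed.

Lemma letter_expand2 n (p : 'I_n) (a b : letter n) :
  word_class (word_expand p [:: a; b]) =
  word_class (letter_expand p a) * word_class (letter_expand (letter_perm a p) b).
Proof. by rewrite /= cats0 word_class_cat. Qed.

Lemma word_expand_relator n (p : 'I_n) (u v : word n) : cactus_relator u v ->
  word_class (word_expand p u) = word_class (word_expand p v).
Proof.
have ltp := ltn_ord p.
case=> [a|a b h|a b c h1 h2 ec1 ec2]; rewrite ?letter_expand2 !letter_expandE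
  !letter_permE /flip.
- have ha := lo_hi a; have [h1|h1] : (hi a < p)%N \/ (p <= hi a)%N by lia.
    have -> : (lo a <= p <= hi a)%N = false by lia.
    by rewrite h1 sgen2.
  have [h2|h2] : (p < lo a)%N \/ (lo a <= p)%N by lia.
    have -> : (lo a <= p <= hi a)%N = false by lia.
    have -> : (hi a < p)%N = false by lia.
    by rewrite h2 sgen2.
  have -> : (lo a <= p <= hi a)%N by lia.
  have -> : (hi a < p)%N = false by lia.
  have -> : (p < lo a)%N = false by lia.
  have -> : (hi a < lo a + hi a - p)%N = false by lia.
  have -> : (lo a + hi a - p < lo a)%N = false by lia.
  rewrite -mulgA [X in _ * X]mulgA.
  rewrite (@sgenN n.+1 (lo a) (hi a).+1 _ _ p p.+1); try lia.
  by rewrite !mulgA sgen2 mul1g sgen2.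
- have ha := lo_hi a; have hb := lo_hi b.
  have [q1|q1] := boolP (lo a <= p <= hi a)%N.
    have -> : (hi a < p)%N = false by lia.
    have -> : (p < lo a)%N = false by lia.
    have -> : (lo b <= p <= hi b)%N = false by lia.
    have -> : (hi b < p)%N = false by lia.
    have -> : (p < lo b)%N by lia.
    have -> : (hi b < lo a + hi a - p)%N = false by lia.
    have -> : (lo a + hi a - p < lo b)%N by lia.
    have -> : (hi a < p)%N = false by lia.
    have -> : (p < lo a)%N = false by lia.
    rewrite -mulgA (@sgenC n.+1 (lo a) (hi a).+1 (lo b).+1 (hi b).+1); try lia.
    rewrite mulgA (@sgenC n.+1 p p.+1 (lo b).+1 (hi b).+1) ?mulgA //; lia.
  have [q2|q2] := boolP (lo b <= p <= hi b)%N.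
    have -> : (hi a < p)%N by lia.
    have -> : (hi a < lo b + hi b - p)%N by lia.
    have -> : (hi b < p)%N = false by lia.
    have -> : (p < lo b)%N = false by lia.
    rewrite mulgA (@sgenC n.+1 (lo a) (hi a) p p.+1); try lia.
    rewrite -mulgA (@sgenC n.+1 (lo a) (hi a) (lo b) (hi b).+1) ?mulgA //; lia.
  have [q3|q3] : (p < lo a)%N \/ (hi a < p)%N by lia.
    have -> : (hi a < p)%N = false by lia.
    have -> : (hi b < p)%N = false by lia.
    have -> : (p < lo b)%N by lia.
    by rewrite q3; apply: sgenC; lia.
  have [q4|q4] : (p < lo b)%N \/ (hi b < p)%N by lia.
    have -> : (hi b < p)%N = false by lia.
    by rewrite q3 q4; apply: sgenC; lia.
  by rewrite q3 q4; apply: sgenC; lia.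
have ha := lo_hi a; have hb := lo_hi b; rewrite ec1 ec2.
have [q1|q1] : (hi a < p)%N \/ (p <= hi a)%N by lia.
  have -> : (lo a <= p <= hi a)%N = false by lia.
  have -> : (hi b < p)%N by lia.
  have -> : (lo a + hi a - lo b < p)%N by lia.
  have -> : (lo a + hi a - hi b <= p <= lo a + hi a - lo b)%N = false by lia.
  by rewrite q1; apply: sgenN; lia.
have [q2|q2] : (p < lo a)%N \/ (lo a <= p)%N by lia.
  have -> : (lo a <= p <= hi a)%N = false by lia.
  have -> : (hi b < p)%N = false by lia.
  have -> : (p < lo b)%N by lia.
  have -> : (lo a + hi a - lo b < p)%N = false by lia.
  have -> : (p < lo a + hi a - hi b)%N by lia.
  have -> : (lo a + hi a - hi b <= p <= lo a + hi a - lo b)%N = false by lia.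
  have -> : (hi a < p)%N = false by lia.
  by rewrite q2; apply: sgenN; lia.
have -> : (lo a <= p <= hi a)%N by lia.
have -> : (hi a < p)%N = false by lia.
have -> : (p < lo a)%N = false by lia.
have [q3|q3] : (hi b < lo a + hi a - p)%N \/ (lo a + hi a - p <= hi b)%N by lia.
  have -> : (hi b < lo a + hi a - p)%N by lia.
  have -> : (lo a + hi a - lo b < p)%N = false by lia.
  have -> : (p < lo a + hi a - hi b)%N by lia.
  have -> : (lo a + hi a - hi b <= p <= lo a + hi a - lo b)%N = false by lia.
  have -> : (hi a < p)%N = false by lia.
  have -> : (p < lo a)%N = false by lia.
  rewrite -mulgA (@sgenN n.+1 (lo a) (hi a).+1 (lo b) (hi b)
    (lo a + hi a - hi b).+1 (lo a + hi a - lo b).+1); try lia.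
  by rewrite !mulgA; congr (_ * _); apply: sgenC; lia.
have -> : (hi b < lo a + hi a - p)%N = false by lia.
have [q4|q4] : (lo a + hi a - p < lo b)%N \/ (lo b <= lo a + hi a - p)%N by lia.
  have -> : (lo a + hi a - p < lo b)%N by lia.
  have -> : (lo a + hi a - lo b < p)%N by lia.
  have -> : (lo a + hi a - hi b <= p <= lo a + hi a - lo b)%N = false by lia.
  have -> : (hi a < p)%N = false by lia.
  have -> : (p < lo a)%N = false by lia.
  rewrite -mulgA (@sgenN n.+1 (lo a) (hi a).+1 (lo b).+1 (hi b).+1
    (lo a + hi a - hi b) (lo a + hi a - lo b)); try lia.
  by rewrite !mulgA; congr (_ * _); apply/esym; apply: sgenC; lia.
have -> : (lo a + hi a - p < lo b)%N = false by lia.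
have -> : (lo a + hi a - lo b < p)%N = false by lia.
have -> : (p < lo a + hi a - hi b)%N = false by lia.
have -> : (lo a + hi a - hi b <= p <= lo a + hi a - lo b)%N by lia.
set q := (lo a + hi a - hi b + (lo a + hi a - lo b) - p)%N.
have -> : (hi a < q)%N = false by rewrite /q; lia.
have -> : (q < lo a)%N = false by rewrite /q; lia.
rewrite -!mulgA (mulgA (sgen _ (lo a) _)).
rewrite (@sgenN n.+1 (lo a) (hi a).+1 _ _ p p.+1); try lia.
rewrite !mulgA sgen2 mul1g.
rewrite -(mulgA _ _ (sgen _ q _)).
rewrite (@sgenN n.+1 (lo a + hi a - hi b) (lo a + hi a - lo b).+1 _ _ p p.+1);
  rewrite /q; try lia.
rewrite !mulgA sgen2 mul1g.
by apply: sgenN; lia.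
Qed.

Lemma cactus_expandE n (p : 'I_n) (w : word n) :
  cactus_expand p (word_class w) = word_class (word_expand p w).
Proof.
pose f u := word_class (word_expand p u).
apply: (word_equiv_ind (f := f)) (word_equiv_repr w) => u v l r lr.
rewrite /f !word_expand_cat !word_class_cat (word_expand_relator _ lr).
by rewrite (relator_perm lr).
Qed.

Lemma cactus_expandM n (p : 'I_n) (s t : cactus n) :
  cactus_expand p (s * t) = cactus_expand p s * cactus_expand (cactus_perm s p) t.
Proof.
have [u ->] := word_class_surj s; have [v ->] := word_class_surj t.
by rewrite -word_class_cat cactus_permE !cactus_expandE word_expand_cat word_class_cat.
Qed.

Lemma perm_expandM n (i : 'I_n) (s t : 'S_n) :
  perm_expand i (s * t) = perm_expand i s * perm_expand (s i) t.
Proof. by rewrite /perm_expand lift_permM permM. Qed.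

Lemma perm_expand1 n (i : 'I_n) : perm_expand i 1 = 1.
Proof. by rewrite /perm_expand perm1 lift_perm1. Qed.

Lemma gen_word_perm n i j (m : 'I_n) : (i < j < n)%N ->
  word_perm (gen_word n i j) m = flip i j m :> nat.
Proof.
move=> h; rewrite (gen_wordE h) /word_perm big_cons big_nil mulg1.
by rewrite letter_permE.
Qed.

Lemma letter_expand_perm n (p : 'I_n) (a : letter n) :
  word_perm (letter_expand p a) = perm_expand p (letter_perm a).
Proof.
have ha := lo_hi a; have ltp := ltn_ord p.
apply/permP => m; apply: ord_inj.
have -> : perm_expand p (letter_perm a) m
   = (if m == p.+1 :> nat then (flip (lo a) (hi a) p).+1
     else flip (lo a) (hi a) (m - (p < m)) +
       (flip (lo a) (hi a) p < flip (lo a) (hi a) (m - (p < m))))%N :> nat.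
  case: (unliftP (right_child p) m) => [k ->|->].
    rewrite -/(old_leaf p k) perm_expand_old !old_leafE !letter_permE.
    have -> : (k + (p < k) - (p < k + (p < k)))%N = k by lia.
    by have -> : (k + (p < k) == p.+1)%N = false by lia.
  by rewrite perm_expand_right !right_childE eqxx letter_permE.
have ltm := ltn_ord m; rewrite /letter_expand.
have [q1|q1] : (hi a < p)%N \/ (p <= hi a)%N by lia.
  rewrite q1 gen_word_perm; last lia.
  have -> : flip (lo a) (hi a) p = p by rewrite /flip; case: ifP; lia.
  rewrite /flip; repeat case: ifP; lia.
have -> : (hi a < p)%N = false by lia.
have [q2|q2] : (p < lo a)%N \/ (lo a <= p)%N by lia.
  rewrite q2 gen_word_perm; last lia.
  have -> : flip (lo a) (hi a) p = p by rewrite /flip; case: ifP; lia.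
  rewrite /flip; repeat case: ifP; lia.
have -> : (p < lo a)%N = false by lia.
rewrite word_perm_cat permM !gen_word_perm; try lia.
have -> : flip (lo a) (hi a) p = (lo a + hi a - p)%N by rewrite /flip; case: ifP; lia.
have [q|q] : (m < lo a \/ hi a < m.-1)%N \/ (lo a <= m <= (hi a).+1)%N by lia.
  have -> : flip p p.+1 m = m by rewrite /flip; case: ifP; lia.
  have -> : (m == p.+1 :> nat) = false by lia.
  rewrite /flip; repeat case: ifP; lia.
have [e|/negPf e] := eqVneq (m : nat) p.+1.
  have -> : flip p p.+1 m = p by rewrite e /flip; case: ifP; lia.
  by rewrite /flip; case: ifP; lia.
have [e'|e'] := eqVneq (m : nat) p.
  have -> : flip p p.+1 m = p.+1 by rewrite e' /flip; case: ifP; lia.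
  have -> : (m - (p < m))%N = p by lia.
  by rewrite /flip; repeat case: ifP; lia.
have -> : flip p p.+1 m = m by rewrite /flip; case: ifP; lia.
by rewrite /flip; repeat case: ifP; lia.
Qed.

Lemma word_expand_perm n (p : 'I_n) (w : word n) :
  word_perm (word_expand p w) = perm_expand p (word_perm w).
Proof.
elim: w p => [|a w IH] p /=; first by rewrite /word_perm !big_nil perm_expand1.
by rewrite word_perm_cat IH letter_expand_perm /word_perm big_cons perm_expandM.
Qed.

Lemma cactus_perm_expand n (p : 'I_n) (s : cactus n) :
  cactus_perm (cactus_expand p s) = perm_expand p (cactus_perm s).
Proof.
have [w ->] := word_class_surj s.
by rewrite cactus_expandE !cactus_permE word_expand_perm.
Qed.

Lemma cactus_expand1 n (p : 'I_n) : cactus_expand p (1 : cactus n) = 1.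
Proof. exact: (cactus_expandE p [::]). Qed.

Lemma cactus_expand_sgen n (p : 'I_n) i j : (i < j < n)%N ->
  cactus_expand p (sgen n i j) =
    if (j < p)%N then sgen n.+1 i j
    else if (p < i)%N then sgen n.+1 i.+1 j.+1
    else sgen n.+1 p p.+1 * sgen n.+1 i j.+1.
Proof.
move=> h; rewrite /sgen (gen_wordE h) cactus_expandE /= cats0.
exact: letter_expandE.
Qed.

Lemma cactus_perm_sgen n (p : 'I_n) i j : (i < j < n)%N ->
  cactus_perm (sgen n i j) p = flip i j p :> nat.
Proof. by move=> h; rewrite cactus_permE gen_word_perm. Qed.

Lemma cactus_expandC_letter n (i j : 'I_n) (a : letter n) : i != j ->
  cactus_expand (old_leaf i j) (cactus_expand i (word_class [:: a])) =
  cactus_expand (old_leaf j i) (cactus_expand j (word_class [:: a])).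
Proof.
move=> ne; wlog ltij : i j ne / (i < j)%N.
  move=> wl; have [lt|lt|/ord_inj e] := ltngtP i j; first exact: (wl i j).
    by apply/esym; apply: wl; rewrite // eq_sym.
  by rewrite e eqxx in ne.
have ha := lo_hi a; have lti := ltn_ord i; have ltj := ltn_ord j.
have -> : word_class [:: a] = sgen n (lo a) (hi a).
  rewrite /sgen (gen_wordE ha); congr (word_class [:: _]); apply: val_inj.
  by rewrite /= /lo /hi -surjective_pairing.
have oi : old_leaf j i = i :> nat by rewrite old_leafE; lia.
have oj : old_leaf i j = j.+1 :> nat by rewrite old_leafE; lia.
rewrite !cactus_expand_sgen //.
have [q1|q1] : (hi a < i)%N \/ (i <= hi a)%N by lia.
  have -> : (hi a < j)%N by lia.
  rewrite q1 !cactus_expand_sgen ?oi ?oj; try lia.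
  by rewrite q1 ifT //; lia.
have q1' : (hi a < i)%N = false by lia.
rewrite q1'.
have [q2|q2] : (j < lo a)%N \/ (lo a <= j)%N by lia.
  have -> : (i < lo a)%N by lia.
  have -> : (hi a < j)%N = false by lia.
  rewrite q2 !cactus_expand_sgen ?oi ?oj; try lia.
  have -> : ((hi a).+1 < j.+1)%N = false by lia.
  have -> : (j.+1 < (lo a).+1)%N by lia.
  have -> : ((hi a).+1 < i)%N = false by lia.
  by have -> : (i < (lo a).+1)%N by lia.
have q2' : (j < lo a)%N = false by lia.
rewrite q2'.
have [q3|q3] : (i < lo a)%N \/ (lo a <= i)%N by lia.
  rewrite q3; have [q4|q4] : (hi a < j)%N \/ (j <= hi a)%N by lia.
    rewrite q4 !cactus_expand_sgen ?oi ?oj; try lia.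
    by rewrite !ltnS q3 q4 q1'.
  have -> : (hi a < j)%N = false by lia.
  rewrite cactus_expandM !cactus_expand_sgen ?oi ?oj; try lia.
  rewrite cactus_perm_sgen; last lia.
  have -> : flip j j.+1 (old_leaf j i) = i by rewrite oi /flip; case: ifP; lia.
  have -> : ((hi a).+1 < j.+1)%N = false by lia.
  have -> : (j.+1 < (lo a).+1)%N = false by lia.
  have -> : (j.+1 < i)%N = false by lia.
  have -> : (i < j)%N by lia.
  have -> : ((hi a).+1 < i)%N = false by lia.
  by rewrite q3.
have q3' : (i < lo a)%N = false by lia.
rewrite q3'; have [q4|q4] : (hi a < j)%N \/ (j <= hi a)%N by lia.
  rewrite q4 cactus_expandM !cactus_expand_sgen ?oi ?oj; try lia.
  rewrite cactus_perm_sgen; last lia.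
  have -> : flip i i.+1 (old_leaf i j) = j.+1 by rewrite oj /flip; case: ifP; lia.
  have -> : (i.+1 < j.+1)%N by lia.
  have -> : ((hi a).+1 < j.+1)%N by lia.
  by rewrite q1' q3'.
have -> : (hi a < j)%N = false by lia.
rewrite !cactus_expandM !cactus_expand_sgen ?oi ?oj; try lia.
rewrite !cactus_perm_sgen; try lia.
have -> : flip j j.+1 (old_leaf j i) = i by rewrite oi /flip; case: ifP; lia.
have -> : flip i i.+1 (old_leaf i j) = j.+1 by rewrite oj /flip; case: ifP; lia.
have -> : (i.+1 < j.+1)%N by lia.
have -> : (j.+1 < i)%N = false by lia.
have -> : (i < j)%N by lia.
have -> : ((hi a).+1 < j.+1)%N = false by lia.
have -> : (j.+1 < lo a)%N = false by lia.
have -> : ((hi a).+1 < i)%N = false by lia.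
by rewrite q3' !mulgA; congr (_ * _); apply: sgenC; lia.
Qed.

Lemma cactus_expandC n (i j : 'I_n) (s : cactus n) : i != j ->
  cactus_expand (old_leaf i j) (cactus_expand i s) =
  cactus_expand (old_leaf j i) (cactus_expand j s).
Proof.
have [w ->] := word_class_surj s; elim: w i j => [|a w IH] i j ne.
  by rewrite -[word_class [::]]/(1 : cactus n) !cactus_expand1.
rewrite -cat1s word_class_cat !cactus_expandM !cactus_perm_expand.
rewrite !perm_expand_old cactus_expandC_letter // IH //.
by rewrite (inj_eq perm_inj).
Qed.

Lemma perm_expandC n (i j : 'I_n) (s : 'S_n) : i != j ->
  perm_expand (old_leaf i j) (perm_expand i s) =
  perm_expand (old_leaf j i) (perm_expand j s).
Proof.
have rcE (a b : 'I_n) : a != b ->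
  right_child (old_leaf a b) = old_leaf (old_leaf b a) (right_child b).
  move=> /eqP ne; apply: ord_inj; rewrite old_leafE !right_childE !old_leafE.
  have : a <> b :> nat by move/ord_inj.
  lia.
have olE (a b k : 'I_n) : a != b ->
  old_leaf (old_leaf a b) (old_leaf a k) = old_leaf (old_leaf b a) (old_leaf b k).
  move=> /eqP ne; apply: ord_inj; rewrite !old_leafE.
  have : a <> b :> nat by move/ord_inj.
  lia.
move=> ne; have nes : s i != s j by rewrite (inj_eq perm_inj).
have ne' : j != i by rewrite eq_sym.
have nes' : s j != s i by rewrite eq_sym.
apply/permP => m; case: (unliftP (right_child (old_leaf i j)) m) => [m' ->|->]; last first.
  by rewrite perm_expand_right (rcE _ _ ne) !(perm_expand_old, perm_expand_right) rcE.
case: (unliftP (right_child i) m') => [k ->|->]; rewrite -!/(old_leaf _ _).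
  by rewrite !perm_expand_old (olE _ _ _ ne) !perm_expand_old olE.
by rewrite !(perm_expand_old, perm_expand_right) -(rcE _ _ ne')
  !(perm_expand_old, perm_expand_right) -rcE.
Qed.

Definition perm_system : cloning_system :=
  @CloningSystem (fun n => 'S_n) (fun n s => s) perm_expand
    (fun _ _ _ => erefl) perm_expandM (fun _ _ _ => erefl) perm_expandC.

Definition cactus_system : cloning_system :=
  CloningSystem cactus_permM cactus_expandM cactus_perm_expand cactus_expandC.

Definition V : groupType := thompson perm_system.

Definition CV : groupType := thompson cactus_system.

Definition pair_perm (x : tree_pair cactus_system) : tree_pair perm_system :=
  let: existT n (p, s, m) := x in @tpair perm_system n p (cactus_perm s) m.

(** See [pibarE] for the value on an arbitrary representative. *)
Definition pibar (g : CV) : V := pair_class (pair_perm (repr g)).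

Lemma pair_perm_equiv x y : pair_equiv x y -> pair_equiv (pair_perm x) (pair_perm y).
Proof.
elim=> [{}x {}y [n p s m i]|{}x|{}x {}y _|{}x {}y z _ h1 _ h2].
- apply: rst_step; rewrite /= cactus_perm_expand.
  exact: (@Expansion perm_system n p (cactus_perm s) m i).
- exact: rst_refl.
- exact: rst_sym.
exact: rst_trans h1 h2.
Qed.

Lemma pibarE x : pibar (pair_class x) = pair_class (pair_perm x).
Proof.
apply/pair_classP/pair_perm_equiv/pair_classP.
by rewrite /pair_class reprK.
Qed.

Lemma pibar_mul x y z : pair_mul x y z ->
  pair_mul (pair_perm x) (pair_perm y) (pair_perm z).
Proof.
case=> n p q m s t; rewrite /= cactus_permM.
exact: (@PairMul perm_system).
Qed.

Lemma pibarM (g h : CV) : pibar (g * h) = pibar g * pibar h.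
Proof.
have [x [y [z [m eg eh ek]]]] := tmulP g h.
rewrite {1}[g * h]ek eg eh !pibarE.
exact/esym/tmulE/pibar_mul.
Qed.

Lemma pibar1 : pibar 1 = 1.
Proof. by apply: (mulgI (pibar 1)); rewrite -pibarM !mulg1. Qed.

HB.instance Definition _ := isUMagmaMorphism.Build CV V pibar (pibar1, pibarM).

Definition pibar_ker : {pred CV} := [pred g | pibar g == 1].

Lemma pibar_kerP (g : CV) : reflect (pibar g = 1) (g \in pibar_ker).
Proof. exact: (@eqP V (pibar g) 1). Qed.

Lemma pibar_ker_group : group_closed pibar_ker.
Proof.
split=> [|g h /pibar_kerP hg /pibar_kerP hh]; apply/pibar_kerP.
  exact: pibar1.
by rewrite gmulfF /= hg hh divgg.
Qed.

Definition PCV_carrier : Type := {g : CV | g \in pibar_ker}.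
HB.instance Definition _ := SubChoice.on PCV_carrier.
HB.instance Definition _ :=
  SubChoice_isSubGroup.Build CV pibar_ker PCV_carrier pibar_ker_group.
Definition PCV : groupType := PCV_carrier.

Definition center (G : groupType) : set G := [set z | forall g : G, commute z g].

Arguments center : clear implicits.

(* Main.v *)
From Stdlib Require Import Relations.Relation_Operators.
Require Import Defs.
From mathcomp Require Import boolp classical_sets.
From mathcomp Require Import all_boot all_fingroup all_algebra zify.
From mathcomp Require Import generic_quotient.

Set Implicit Arguments.
Unset Strict Implicit.
Unset Printing Implicit Defensive.

Import GRing.Theory Num.Theory.

(** Everything rests on a statement about cactus groups: for [n >= 5], a pure
    element of [J_n] that commutes with every pure element is [1]
    ([pure_central_trivial]).

    Label the strands by their initial positions and let each letter of a word
    stand for the set of strands that it reverses. The relations of [J_n] then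
    say that these sets behave like the generators of a right-angled Coxeter
    group, in which [A] and [B] commute unless they cross, i.e. overlap without
    one containing the other. The reflection representation of that Coxeter
    group, twisted by the permutations of the strands, is an action of [J_n] on
    integer-valued functions of a set of strands ([letter_act], [relator_act]).
    As for Coxeter groups, the coordinate at [A] of [g x], for [x] in the
    positive cone, has a sign that only depends on [g] and [A]
    ([reduced_sign]); [g] lies [beyond] the wall of [A] when it is negative.
    Three facts about walls do all the work: the generator of an interval [A]
    exchanges the two sides of the wall of [A] ([beyond_gen_left]), the far
    sides of crossing walls are disjoint ([beyond_crosses]), and right
    multiplication by a generator crosses only one wall ([beyond_gen_right]).

    A pure [u <> 1] lies beyond the wall of an interval with at least two
    elements which is not the set of all strands ([exists_beyond]). If it is
    central among pure elements, so are its conjugates, and conjugation by the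
    generator of an interval [C] crossing [A] produces an element beyond the wall
    of [C] ([beyond_conj]). One may thus walk from [A] to the interval [2..4].
    But [t = (s_(0,2) s_(1,3))^2] is pure, and [u t = t u] is impossible: [u t]
    lies beyond [2..4] as [u] does, since [t] never reverses that set, whereas
    [t u] is pushed beyond [0..2] by playing ping-pong with the crossing walls
    of [0..2] and [1..3], and [0..2] crosses [2..4] ([not_central_beyond_24]).

    For [PCV]: an element of the kernel is the class of some [(T, s, T)] with
    [s] pure and with as many leaves as desired ([kernel_diag]). Expansions are
    injective on labels, because forgetting the new strand undoes them
    ([cactus_expandK]); hence [s] commutes with all pure [r] as soon as the class
    of [(T, s, T)] commutes with those of [(T, r, T)] ([kernel_center]).

    For [CV], it remains to see that a central element [z], the class of
    [(P, s, Q)], lies in the kernel ([center_kernel]). Conjugation by [z] takes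
    the class of [(P, r, P)] to that of [(Q, s^-1 r s, Q)], so these classes have
    the same fixed points among infinite binary sequences, for all [r]. Since
    [J_n] contains permutations that fix one given leaf and move another, the
    leaf of [Q] above any sequence is the image by [s] of the leaf of [P] above
    it. This forces [P = Q] and makes [s] pure. *)

(** * Crossing sets *)

Section Crossing.
Variable T : finType.
Implicit Types A B : {set T}.

Definition crosses A B :=
  [&& A :&: B != set0, ~~ (A \subset B) & ~~ (B \subset A)].

Lemma crossesC A B : crosses A B = crosses B A.
Proof. by rewrite /crosses setIC; congr (_ && _); rewrite andbC. Qed.

Lemma crosses_sub A B : A \subset B -> ~~ crosses A B.
Proof. by rewrite /crosses => ->; rewrite andbF. Qed.

Lemma crosses_imset (f : T -> T) A B : injective f ->
  crosses (f @: A) (f @: B) = crosses A B.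
Proof.
move=> fI; rewrite /crosses -imsetI; last by move=> ? ? _ _; apply: fI.
have sub (C D : {set T}) : (f @: C \subset f @: D) = (C \subset D).
  apply/idP/idP => [/subsetP h|h]; last exact: (imsetS f h).
  by apply/subsetP => x xC; have := h _ (imset_f f xC); rewrite mem_imset.
by rewrite !sub imset_eq0.
Qed.

End Crossing.

(** * The reflection representation of the cactus group *)

Section Action.
Local Open Scope ring_scope.
Variable n : nat.
Implicit Types (a b c : letter n) (A B C : {set 'I_n}) (w : word n).

Definition strands a : {set 'I_n} := [set i : 'I_n | (lo a <= i <= hi a)%N].

(** The bilinear form of the Coxeter group on basis vectors: [1] on the diagonal,
    [-1] for the infinite edges, i.e. for crossing sets, and [0] for commuting
    generators. *)
Definition reflect_coef A B : int :=
  if A == B then 1 else if crosses A B then -1 else 0.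

Definition vec := {set 'I_n} -> int.

(** The dual of the reflection in the basis vector of [strands a], composed with
    the permutation of the coordinates by the flip of [a]. The latter accounts
    for later letters naming positions instead of strands. *)
Definition letter_act a (x : vec) : vec := fun B =>
  x (letter_perm a @: B) - 2 * reflect_coef (strands a) B * x (strands a).

Definition word_act w (x : vec) : vec := foldr letter_act x w.

Lemma word_act_cat u v x : word_act (u ++ v) x = word_act u (word_act v x).
Proof. exact: foldr_cat. Qed.

Lemma letter_permK a : involutive (letter_perm a).
Proof. by move=> i; rewrite !permE letter_funK. Qed.

Lemma imset_letterK a : involutive (fun A => letter_perm a @: A).
Proof.
move=> A; rewrite -imset_comp -[RHS]imset_id.
by apply: eq_imset => i; apply: letter_permK.
Qed.

Lemma mem_letter a A (i : 'I_n) :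
  (i \in letter_perm a @: A) = (letter_perm a i \in A).
Proof.
by rewrite -{1}[i](letter_permK a) mem_imset //; apply: perm_inj.
Qed.

Lemma strands_sub_letter a b c :
  (lo a <= lo b)%N -> (hi b <= hi a)%N ->
  lo c = (lo a + hi a - hi b)%N -> hi c = (lo a + hi a - lo b)%N ->
  letter_perm a @: strands b = strands c.
Proof.
move=> h1 h2 e1 e2; have := lo_hi a; have := lo_hi b => hb ha.
by apply/setP => i; rewrite mem_letter !inE letter_permE /flip e1 e2; case: ifP; lia.
Qed.

Lemma strands_self a : letter_perm a @: strands a = strands a.
Proof. by have ha := lo_hi a; apply: strands_sub_letter; lia. Qed.

Lemma letter_perm_out a (i : 'I_n) : i \notin strands a -> letter_perm a i = i.
Proof.
by rewrite inE => /negPf h; apply: ord_inj; rewrite letter_permE /flip h.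
Qed.

Lemma letter_perm_in a (i : 'I_n) :
  (letter_perm a i \in strands a) = (i \in strands a).
Proof. by rewrite -mem_letter strands_self. Qed.

Lemma imset_letter_sub a A : strands a \subset A -> letter_perm a @: A = A.
Proof.
move=> /subsetP h; apply/setP => i; rewrite mem_letter.
have [q|/letter_perm_out -> //] := boolP (i \in strands a).
by rewrite !h // letter_perm_in.
Qed.

Lemma imset_letter_disj a A : strands a :&: A = set0 -> letter_perm a @: A = A.
Proof.
move=> h; have out i : i \in strands a -> i \in A = false.
  by move=> ia; have := in_set0 i; rewrite -h inE ia.
apply/setP => i; rewrite mem_letter.
have [q|/letter_perm_out -> //] := boolP (i \in strands a).
by rewrite !out // letter_perm_in.
Qed.

Lemma reflect_coef_letter a A B :
  reflect_coef A (letter_perm a @: B) = reflect_coef (letter_perm a @: A) B.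
Proof.
rewrite /reflect_coef -{1 2}[A](imset_letterK a) (inj_eq (can_inj (imset_letterK a))).
by rewrite crosses_imset //; apply: perm_inj.
Qed.

Lemma reflect_coef0 A B : A != B -> ~~ crosses A B -> reflect_coef A B = 0.
Proof. by rewrite /reflect_coef => /negPf -> /negPf ->. Qed.

Lemma letter_actE_comm a B (x : vec) : strands a != B ->
  ~~ crosses (strands a) B -> letter_act a x B = x (letter_perm a @: B).
Proof. by move=> h1 h2; rewrite /letter_act reflect_coef0 // mulr0 mul0r subr0. Qed.

Lemma letter_actE_self a (x : vec) : letter_act a x (strands a) = - x (strands a).
Proof. by rewrite /letter_act strands_self /reflect_coef eqxx; lia. Qed.

Lemma letter_actE_cross a B (x : vec) : crosses (strands a) B ->
  letter_act a x B = x (letter_perm a @: B) + 2 * x (strands a).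
Proof.
move=> h; rewrite /letter_act /reflect_coef h; case: eqP => [e|_]; last lia.
by rewrite e (negPf (crosses_sub (subxx B))) in h.
Qed.

(** The relations of disjoint and of nested intervals have the same shape
    [a b = c a], where [c] is [b] moved by [a]; they hold for the action because
    the reflections commute and the permutations satisfy the relation. *)
Lemma letter_act_exchange a b c (x : vec) :
  letter_perm a @: strands b = strands c ->
  letter_perm b @: strands a = strands a ->
  letter_perm c @: strands a = strands a ->
  reflect_coef (strands b) (strands a) = 0 ->
  reflect_coef (strands a) (strands c) = 0 ->
  word_perm [:: a; b] = word_perm [:: c; a] ->
  letter_act a (letter_act b x) = letter_act c (letter_act a x).
Proof.
move=> e1 e2 e3 k1 k2 p; apply/funext => B; rewrite /letter_act.
rewrite k1 k2 e2.
have -> : letter_perm a @: strands c = strands b by rewrite -e1 (imset_letterK a).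
have -> : letter_perm b @: (letter_perm a @: B) = letter_perm a @: (letter_perm c @: B).
  rewrite -!imset_comp; apply: eq_imset => i /=.
  by have := congr1 (fun s : 'S_n => s i) p; rewrite !word_perm2 !permM.
by rewrite !reflect_coef_letter e1 e3; lia.
Qed.

Lemma letter_actK a : involutive (letter_act a).
Proof.
move=> x; apply/funext => B; rewrite {1}/letter_act letter_actE_self.
rewrite /letter_act reflect_coef_letter strands_self (imset_letterK a); lia.
Qed.

Lemma strands_disj a b : (hi a < lo b)%N -> strands a :&: strands b = set0.
Proof. by move=> h; apply/setP => i; rewrite !inE; lia. Qed.

Lemma strands_sub a b : (lo a <= lo b)%N -> (hi b <= hi a)%N ->
  strands b \subset strands a.
Proof. by move=> h1 h2; apply/subsetP => i; rewrite !inE; lia. Qed.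

Lemma lo_in a : Ordinal (ltn_trans (andP (lo_hi a)).1 (andP (lo_hi a)).2) \in strands a.
Proof. by have := lo_hi a; rewrite inE /=; lia. Qed.

Lemma hi_in a : Ordinal (andP (lo_hi a)).2 \in strands a.
Proof. by have := lo_hi a; rewrite inE /=; lia. Qed.

Lemma letter_eq a b : lo a = lo b -> hi a = hi b -> a = b.
Proof.
move=> e1 e2; apply: val_inj.
by rewrite (surjective_pairing (val a)) (surjective_pairing (val b)); congr (_, _).
Qed.

Lemma strands_inj : injective strands.
Proof.
move=> a b e.
have [h1 h2] : (lo b <= lo a)%N /\ (hi a <= hi b)%N.
  by move: (lo_in a) (hi_in a); rewrite e !inE /=; lia.
have [h3 h4] : (lo a <= lo b)%N /\ (hi b <= hi a)%N.
  by move: (lo_in b) (hi_in b); rewrite -e !inE /=; lia.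
by apply: letter_eq; lia.
Qed.

Lemma strands_neq0 a : strands a != set0.
Proof. by apply/set0Pn; eexists; apply: lo_in. Qed.

Lemma disjoint_not_crosses A B : A != set0 -> A :&: B = set0 -> A != B /\ ~~ crosses A B.
Proof.
move=> A0 h; split; last by rewrite /crosses h eqxx.
by apply: contraNneq A0 => e; rewrite -h -e setIid.
Qed.

Lemma relator_act u v (x : vec) : cactus_relator u v -> word_act u x = word_act v x.
Proof.
move=> uv; have := relator_perm uv.
case: uv => [a|a b h|a b c h1 h2 ec1 ec2] p.
- exact: letter_actK.
- have ab := strands_disj h; have ba := ab; rewrite setIC in ba.
  have [n1 n2] := disjoint_not_crosses (strands_neq0 a) ab.
  have [n3 n4] := disjoint_not_crosses (strands_neq0 b) ba.
  apply: letter_act_exchange; rewrite ?imset_letter_disj ?reflect_coef0 //.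
have ba := strands_sub h1 h2.
have ha := lo_hi a; have hb := lo_hi b.
have ca : strands c \subset strands a by apply: strands_sub; lia.
have [e|ne] := eqVneq b a.
  by subst b; have -> : c = a by apply: letter_eq; lia.
have nea : strands b != strands a by rewrite (inj_eq strands_inj).
have e1 := strands_sub_letter h1 h2 ec1 ec2.
have nec : strands a != strands c.
  rewrite -e1; apply: contraNneq nea => e.
  by rewrite -(imset_letterK a (strands b)) -e strands_self.
apply: letter_act_exchange => //; rewrite ?imset_letter_sub ?reflect_coef0 //.
  exact: crosses_sub.
by rewrite crossesC crosses_sub.
Qed.

Lemma word_act_class u v (x : vec) : word_class u = word_class v ->
  word_act u x = word_act v x.
Proof.
move=> /word_classP; apply: (word_equiv_ind (f := fun w => word_act w x)).
by move=> s t l r lr; rewrite !word_act_cat (relator_act _ lr).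
Qed.

(** Reflections are trivial modulo 2, so that only the permutation of the
    coordinates remains. This is what keeps the relevant coordinates nonzero. *)
Lemma word_act_mod2 w (x : vec) B :
  exists k : int, word_act w x B = x (word_perm w @: B) + 2 * k.
Proof.
elim: w B => [|a w IH] B.
  exists 0; rewrite /word_perm big_nil /= mulr0 addr0; congr x.
  by rewrite -[LHS]imset_id; apply: eq_imset => i; rewrite perm1.
have [k /= e] := IH (letter_perm a @: B).
exists (k - reflect_coef (strands a) B * word_act w x (strands a)).
rewrite {1}/letter_act e -imset_comp.
suff -> : word_perm (a :: w) @: B = (word_perm w \o letter_perm a) @: B by lia.
by apply: eq_imset => i; rewrite /word_perm big_cons permM.
Qed.

(** The sets of strands that can be brought to the first letter by exchanging
    letters. Once the first letter [a] is dropped, positions are those after the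
    flip of [a], hence the image of [B]. *)
Fixpoint front w B : bool :=
  if w is a :: w' then
    (strands a == B) || (~~ crosses (strands a) B && front w' (letter_perm a @: B))
  else false.

Fixpoint reduced w : bool :=
  if w is a :: w' then ~~ front w' (strands a) && reduced w' else true.

(** A word acts on the positive cone by making a coordinate negative exactly when
    the word can start with its set. The induction on the word needs the second
    half: a coordinate that crosses a negative one is at least as large in
    absolute value, so that a new reflection, adding it twice, makes the negative
    one positive. *)
Lemma reduced_sign w (x : vec) : reduced w -> (forall B, 0 <= x B) ->
  (forall B, if front w B then word_act w x B <= 0 else 0 <= word_act w x B) /\
  (forall B D, front w B -> crosses B D -> 0 <= word_act w x D + word_act w x B).
Proof.
move=> + x0; elim: w => [_|a w IH] //= /andP[nf /IH[sgn dom]].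
set y := word_act w x in sgn dom *.
have ya : 0 <= y (strands a) by have := sgn (strands a); rewrite (negPf nf).
split=> [B|B D].
  have [<-|ne] /= := eqVneq (strands a) B; first by rewrite letter_actE_self; lia.
  have [cr|ncr] /= := boolP (crosses _ _); last first.
    by rewrite letter_actE_comm //; apply: sgn.
  rewrite letter_actE_cross //; have := sgn (letter_perm a @: B).
  case: ifP => [fB yB|_]; last lia.
  (* [letter_perm a @: B] is at the front of [w] and crosses [strands a]: its
     coordinate is dominated by that of [strands a]. *)
  have := dom _ (strands a) fB; rewrite -{1}(strands_self a).
  rewrite crosses_imset; last exact: perm_inj.
  by rewrite crossesC => /(_ cr); lia.
have [<- _ cr|ne /=] := eqVneq (strands a) B.
  rewrite letter_actE_self letter_actE_cross //.
  have := sgn (letter_perm a @: D); case: ifP => [fD yD|_]; last lia.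
  have := dom _ (strands a) fD; rewrite -{1}(strands_self a).
  rewrite crosses_imset; last exact: perm_inj.
  by rewrite crossesC => /(_ cr); lia.
move=> /andP[ncr fB] cr; rewrite (letter_actE_comm _ ne) //.
have crf : crosses (letter_perm a @: B) (letter_perm a @: D).
  by rewrite crosses_imset //; apply: perm_inj.
have h := dom _ _ fB crf.
have [e|neD] := eqVneq (strands a) D; first by rewrite e crossesC cr in ncr.
have [crD|ncrD] := boolP (crosses (strands a) D).
  by rewrite letter_actE_cross // addrAC; apply: addr_ge0 => //; lia.
by rewrite letter_actE_comm.
Qed.

Lemma not_crossesP a b : ~~ crosses (strands a) (strands b) ->
  [\/ (hi a < lo b)%N, (hi b < lo a)%N,
      (lo a <= lo b /\ hi b <= hi a)%N | (lo b <= lo a /\ hi a <= hi b)%N].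
Proof.
have := lo_hi a; have := lo_hi b => hb ha; rewrite /crosses !negb_and !negbK => h.
have [?|q1] := boolP (hi a < lo b)%N; first by constructor 1.
have [?|q2] := boolP (hi b < lo a)%N; first by constructor 2.
case/or3P: h => [/eqP h|/subsetP h|/subsetP h].
- suff [i /andP[ia ib]] : exists i : 'I_n, (i \in strands a) && (i \in strands b).
    by have := in_set0 i; rewrite -h inE ia ib.
  have lt : (maxn (lo a) (lo b) < n)%N by lia.
  by exists (Ordinal lt); rewrite !inE /=; lia.
- constructor 4; have := h _ (lo_in a); have := h _ (hi_in a); rewrite !inE /=; lia.
constructor 3; have := h _ (lo_in b); have := h _ (hi_in b); rewrite !inE /=; lia.
Qed.

Definition mkletter i j (h : (i < j < n)%N) : letter n := exist _ (i, j) h.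

Lemma lo_mkletter i j (h : (i < j < n)%N) : lo (mkletter h) = i.
Proof. by []. Qed.

Lemma hi_mkletter i j (h : (i < j < n)%N) : hi (mkletter h) = j.
Proof. by []. Qed.

(** In the nested case it depends on which interval is contained in the other
    whether the relation changes the first letter or the second. *)
Lemma commute_letters a b : ~~ crosses (strands b) (strands a) ->
  exists d b', strands d = letter_perm b @: strands a /\
    word_class [:: a; b] = word_class [:: b'; d].
Proof.
have := lo_hi a; have := lo_hi b => hb ha /not_crossesP[h|h|[h1 h2]|[h1 h2]].
- exists a, b; rewrite imset_letter_disj; last exact: strands_disj.
  by split=> //; apply/esym/relator_class/RelDisjoint.
- exists a, b; rewrite imset_letter_disj; last by rewrite setIC; apply: strands_disj.
  by split=> //; apply/relator_class/RelDisjoint.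
- have hd : (lo b + hi b - hi a < lo b + hi b - lo a < n)%N by lia.
  exists (mkletter hd), b; split; first by apply/esym/strands_sub_letter.
  by apply/esym/relator_class/RelNested; rewrite ?lo_mkletter ?hi_mkletter; lia.
have hd : (lo a + hi a - hi b < lo a + hi a - lo b < n)%N by lia.
exists a, (mkletter hd); split; first by rewrite imset_letter_sub //; apply: strands_sub.
exact/relator_class/RelNested.
Qed.

Lemma front_cancel w a : front w (strands a) ->
  exists2 w', (size w' < size w)%N & word_class (a :: w) = word_class w'.
Proof.
elim: w a => [|b w IH] a //=.
case/orP=> [/eqP/strands_inj <-|/andP[/commute_letters[d [b' [ed e]]]]].
  exists w; first by [].
  rewrite -[b :: b :: w]/([:: b; b] ++ w) word_class_cat.
  by rewrite (relator_class (RelInvolution b)) -word_class_cat.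
rewrite -ed => /IH[w' ltw ew]; exists (b' :: w') => //.
rewrite -[a :: _]/([:: a; b] ++ w) word_class_cat e -word_class_cat.
by rewrite -[_ ++ w]/([:: b'] ++ d :: w) word_class_cat ew -word_class_cat.
Qed.

Lemma reduced_word w : exists w', [/\ reduced w', (size w' <= size w)%N
  & word_class w = word_class w'].
Proof.
have [k] := ubnP (size w); elim: k w => // k IH [|a w] /= ltk; first by exists [::].
have [w' [rw' ltw' e]] := IH w ltk.
have {e} -> : word_class (a :: w) = word_class (a :: w').
  by rewrite -cat1s -[in RHS]cat1s !word_class_cat e.
have [f|nf] := boolP (front w' (strands a)); last first.
  by exists (a :: w'); split=> //=; rewrite nf.
have [w1 lt1 ->] := front_cancel f.
by have [|w2 [r2 lt2 ->]] := IH w1; [lia|exists w2; split=> //; lia].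
Qed.
End Action.

(** * Walls and their sides *)

Section Sides.
Local Open Scope ring_scope.
Variable n : nat.
Implicit Types (a b c : letter n) (A B C D : {set 'I_n}) (w : word n) (g u : cactus n).

Definition gen a : cactus n := word_class [:: a].

(** The positions in which [g] leaves the strands that start in [A]. *)
Definition moved g A : {set 'I_n} := cactus_perm g @: A.

Lemma gen_perm a : cactus_perm (gen a) = letter_perm a.
Proof. by rewrite cactus_permE /word_perm big_cons big_nil mulg1. Qed.

Lemma moved_gen a A : moved (gen a) A = letter_perm a @: A.
Proof. by rewrite /moved gen_perm. Qed.

Lemma movedM g u A : moved (g * u)%g A = moved u (moved g A).
Proof.
by rewrite /moved cactus_permM -imset_comp; apply: eq_imset => i; rewrite permM.
Qed.

Lemma moved_pure u A : cactus_perm u = 1%g -> moved u A = A.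
Proof.
by move=> e; rewrite /moved e -[RHS]imset_id; apply: eq_imset => i; rewrite perm1.
Qed.

Definition cactus_act g (x : vec n) : vec n := word_act (repr g) x.

Lemma cactus_actE w (x : vec n) : cactus_act (word_class w) x = word_act w x.
Proof. by apply: word_act_class; apply/word_classP/word_equiv_repr. Qed.

Lemma cactus_actM g u (x : vec n) : cactus_act (g * u)%g x = cactus_act g (cactus_act u x).
Proof.
have [v ->] := word_class_surj g; have [w ->] := word_class_surj u.
by rewrite -word_class_cat !cactus_actE word_act_cat.
Qed.

Lemma cactus_act_gen a (x : vec n) : cactus_act (gen a) x = letter_act a x.
Proof. exact: cactus_actE. Qed.

Definition unit_vec A : vec n := fun B => if B == A then 1 else 0.

Lemma unit_vec_ge0 A B : 0 <= unit_vec A B.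
Proof. by rewrite /unit_vec; case: ifP. Qed.

Lemma letter_act_unit_vec a A : strands a != A ->
  letter_act a (unit_vec (letter_perm a @: A)) = unit_vec A.
Proof.
move=> /negPf ne; apply/funext => B; rewrite /letter_act /unit_vec.
rewrite -{2}(strands_self a) !(inj_eq (can_inj (imset_letterK a))) ne.
by rewrite mulr0 subr0.
Qed.

(** The basis vector is the one that [g] carries to the coordinate [A] modulo 2:
    the result is odd, so it has a strict sign. *)
Definition side_coord g A : int := cactus_act g (unit_vec (moved g A)) A.

(** [g] and [1] are on opposite sides of the wall of [A]. *)
Definition beyond g A : bool := side_coord g A < 0.

Lemma side_coord_neq0 g A : side_coord g A != 0.
Proof.
rewrite /side_coord; have [w e] := word_class_surj g.
have [k] := word_act_mod2 w (unit_vec (moved g A)) A.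
rewrite -cactus_actE -e => ->.
have -> : word_perm w = cactus_perm g by rewrite e cactus_permE.
by rewrite /unit_vec eqxx; lia.
Qed.

Lemma beyond_front w A : reduced w -> beyond (word_class w) A = front w A.
Proof.
move=> /reduced_sign rw; have [sgn _] := rw _ (unit_vec_ge0 (moved (word_class w) A)).
have := sgn A; have := side_coord_neq0 (word_class w) A.
rewrite /beyond /side_coord cactus_actE; case: ifP => _; lia.
Qed.

(** Testing one basis vector, as [beyond] does, determines the sign of the
    coordinate on the whole positive cone: apply [reduced_sign] to a reduced word
    of [g]. *)
Lemma beyond_sign g A (x : vec n) : (forall B, 0 <= x B) ->
  if beyond g A then cactus_act g x A <= 0 else 0 <= cactus_act g x A.
Proof.
have [w ->] := word_class_surj g; have [v [rv _ ->]] := reduced_word w => x0.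
by rewrite beyond_front // cactus_actE; apply: (reduced_sign rv x0).1.
Qed.

Lemma beyond_dominates g A B (x : vec n) : (forall B, 0 <= x B) ->
  beyond g A -> crosses A B -> 0 <= cactus_act g x B + cactus_act g x A.
Proof.
have [w ->] := word_class_surj g; have [v [rv _ ->]] := reduced_word w => x0.
by rewrite beyond_front // !cactus_actE; apply: (reduced_sign rv x0).2.
Qed.

(** The far sides of crossing walls are disjoint: otherwise two crossing
    coordinates would be negative, while each is at least the absolute value of
    the other. *)
Lemma beyond_crosses g A B : crosses A B -> beyond g A -> beyond g B = false.
Proof.
move=> cr gA; apply/negP => gB.
have x0 := unit_vec_ge0 (moved g A).
have := beyond_dominates x0 gA cr; have := beyond_sign g B x0; rewrite gB.
move: gA; rewrite /beyond /side_coord; lia.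
Qed.

Lemma beyond_gen_left a g : beyond (gen a * g)%g (strands a) = ~~ beyond g (strands a).
Proof.
have := side_coord_neq0 g (strands a).
rewrite /beyond /side_coord cactus_actM cactus_act_gen letter_actE_self.
by rewrite movedM moved_gen strands_self; lia.
Qed.

(** The chambers of [g] and of [g * gen c] are only separated by the wall of the
    set that [g] moves to [strands c]. Concretely, the generator [c] fixes every
    basis vector but its own, up to the permutation of coordinates. *)
Lemma beyond_gen_right g c A : strands c != moved g A ->
  beyond (g * gen c)%g A = beyond g A.
Proof.
move=> ne; rewrite /beyond /side_coord cactus_actM cactus_act_gen movedM moved_gen.
by rewrite letter_act_unit_vec.
Qed.

(** As [u] is beyond the wall of [A], its coordinate at [strands c] is positive
    at the basis vector of [A], to compensate for the negative coordinate at [A].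
    Conjugation by [c] turns this sign around. *)
Lemma beyond_conj u c A : cactus_perm u = 1%g -> beyond u A ->
  crosses A (strands c) -> beyond (gen c * u * gen c)%g (strands c).
Proof.
move=> pu uA cr; apply/contraT => h.
have ne : strands c != A.
  by apply/negP => /eqP e; rewrite e (negPf (crosses_sub (subxx A))) in cr.
have := beyond_sign (gen c * u * gen c)%g (strands c) (unit_vec_ge0 (letter_perm c @: A)).
rewrite (negPf h) !cactus_actM !cactus_act_gen letter_actE_self letter_act_unit_vec //.
have := beyond_dominates (unit_vec_ge0 A) uA cr.
by move: uA; rewrite /beyond /side_coord moved_pure //; lia.
Qed.

(** A reduced word of [u] is beyond the wall of its first letter. That letter may
    reverse all strands; then the second letter exists, because the flip of all
    strands is not pure, and it can be exchanged with the first one. *)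
Lemma exists_beyond u : (2 <= n)%N -> cactus_perm u = 1%g -> u != 1%g ->
  exists a, (hi a - lo a < n.-1)%N /\ beyond u (strands a).
Proof.
move=> n2; have [w ->] := word_class_surj u; have [v [rv _ ->]] := reduced_word w.
case: v rv => [|a v] rv pv; first by rewrite eqxx.
move=> _; have [p|full] := boolP (hi a - lo a < n.-1)%N.
  by exists a; rewrite p beyond_front //= eqxx.
have ha := lo_hi a.
(* Now [a] reverses all strands: every set is nested in [strands a]. *)
have inT i : i \in strands a by have := ltn_ord i; rewrite inE; lia.
have sub A : A \subset strands a by apply/subsetP => i _.
case: v rv pv => [|b v] rv pv.
  have lt0 : (0 < n)%N by lia.
  move: pv; rewrite -/(gen a) gen_perm => /(congr1 (fun s : 'S_n => val (s (Ordinal lt0)))).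
  by rewrite /= perm1 /= letter_permE /flip /=; case: ifP; lia.
have hb := lo_hi b.
have ne : strands a != strands b.
  by move: rv => /= /andP[]; rewrite negb_or eq_sym => /andP[].
have hd : (lo a + hi a - hi b < lo a + hi a - lo b < n)%N by lia.
exists (mkletter hd); have e : strands (mkletter hd) = letter_perm a @: strands b.
  by apply/esym/strands_sub_letter => //; lia.
split.
  rewrite lo_mkletter hi_mkletter.
  suff : ~~ ((lo b == lo a) && (hi b == hi a)) by lia.
  apply: contraNN ne => /andP[/eqP e1 /eqP e2].
  by apply/eqP; congr strands; apply: letter_eq.
rewrite beyond_front // e /=; apply/orP; right.
by rewrite crossesC crosses_sub //= (imset_letterK a) eqxx.
Qed.

End Sides.

(** * The center of the pure cactus group *)

Section PureCenter.
Variable n : nat.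
Implicit Types (a b c : letter n) (g u r : cactus n).
Local Open Scope group_scope.

Definition pure_central u :=
  cactus_perm u = 1 /\ forall r, cactus_perm r = 1 -> u * r = r * u.

Lemma gen_gen c : gen c * gen c = 1.
Proof.
by rewrite -word_class_cat; apply: relator_class (RelInvolution c).
Qed.

Lemma cactus_perm1 : cactus_perm (1 : cactus n) = 1.
Proof. by rewrite cactus_permE /word_perm big_nil. Qed.

Lemma conj_pure u c : cactus_perm u = 1 -> cactus_perm (gen c * u * gen c) = 1.
Proof.
by move=> e; rewrite !cactus_permM e mulg1 -cactus_permM gen_gen cactus_perm1.
Qed.

Lemma conj_pure_central u c : pure_central u -> pure_central (gen c * u * gen c).
Proof.
move=> [pu cu]; split=> [|r pr]; first exact: conj_pure.
have e := cu _ (conj_pure c pr).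
have -> : r * (gen c * u * gen c) = gen c * (gen c * r * gen c * u) * gen c.
  by rewrite !mulgA gen_gen mul1g.
by rewrite -e !mulgA -(mulgA _ (gen c) (gen c)) gen_gen mulg1.
Qed.

(** Central pure elements are considered all together, because the conjugations
    that move the interval also change the element. *)
Definition central_beyond a := exists2 u, pure_central u & beyond u (strands a).

Lemma central_beyond_crosses a c : crosses (strands a) (strands c) ->
  central_beyond a -> central_beyond c.
Proof.
move=> cr [u cu ua]; exists (gen c * u * gen c); first exact: conj_pure_central.
by apply: beyond_conj ua cr; case: cu.
Qed.

Lemma crosses_letters a c : (lo a < lo c)%N -> (lo c <= hi a)%N -> (hi a < hi c)%N ->
  crosses (strands a) (strands c).
Proof.
move=> h1 h2 h3; have ha := lo_hi a; have hc := lo_hi c; apply/and3P; split.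
- apply/set0Pn; exists (Ordinal (andP (lo_hi a)).2).
  by rewrite inE hi_in inE /=; lia.
- by apply/negP => /subsetP /(_ _ (lo_in a)); rewrite inE /=; lia.
by apply/negP => /subsetP /(_ _ (hi_in c)); rewrite inE /=; lia.
Qed.

Lemma central_beyond_right a c : (lo a < lo c)%N -> (lo c <= hi a)%N -> (hi a < hi c)%N ->
  central_beyond a -> central_beyond c.
Proof. by move=> h1 h2 h3; apply: central_beyond_crosses; apply: crosses_letters. Qed.

Lemma central_beyond_left a c : (lo c < lo a)%N -> (lo a <= hi c)%N -> (hi c < hi a)%N ->
  central_beyond a -> central_beyond c.
Proof.
by move=> h1 h2 h3; apply: central_beyond_crosses; rewrite crossesC; apply: crosses_letters.
Qed.

(** Every interval that misses some strand crosses an interval with two elements,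
    and the intervals [i..i+1] and [i+1..i+2] cross. *)
Lemma central_beyond_12 (h : (1 < 2 < n)%N) a :
  (hi a - lo a < n.-1)%N -> central_beyond a -> central_beyond (mkletter h).
Proof.
move=> pa sa; have ha := lo_hi a.
have [i [hi sep]] : exists i, exists h : (i < i.+1 < n)%N, central_beyond (mkletter h).
  have [q|q] : (hi a < n.-1)%N \/ (0 < lo a)%N by lia.
    have h' : (hi a < (hi a).+1 < n)%N by lia.
    exists (hi a), h'.
    by apply: central_beyond_right sa; rewrite ?lo_mkletter ?hi_mkletter; lia.
  have h' : ((lo a).-1 < (lo a).-1.+1 < n)%N by lia.
  exists (lo a).-1, h'.
  by apply: central_beyond_left sa; rewrite ?lo_mkletter ?hi_mkletter; lia.
elim: i hi sep => [|[|i] IH] hi.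
- by apply: central_beyond_right; rewrite ?lo_mkletter ?hi_mkletter; lia.
- by rewrite (bool_irrelevance hi h).
move=> sep; have h' : (i.+1 < i.+2 < n)%N by lia.
by apply: (IH h'); apply: central_beyond_left sep; rewrite ?lo_mkletter ?hi_mkletter; lia.
Qed.

(** With [a = s_(0,2)] and [b = s_(1,3)], the element [t = a b a b] is pure.
    [u t] is beyond the wall of [2..4] like [u], since no letter of [t] crosses
    that wall. But [t u] is beyond the wall of [0..2]: starting from the far side
    of the wall of [2..4], the letters [b, a, b, a] lead alternately to the far
    sides of the crossing walls of [1..3] and [0..2]. *)
Lemma not_central_beyond_24 (h : (2 < 4 < n)%N) : ~ central_beyond (mkletter h).
Proof.
case=> u [pu cu]; set A := strands _ => uA.
have ha : (0 < 2 < n)%N by lia.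
have hb : (1 < 3 < n)%N by lia.
pose a := mkletter ha; pose b := mkletter hb.
have crA c : c = a \/ c = b -> crosses (strands c) A.
  by case=> ->; apply: crosses_letters; rewrite ?lo_mkletter ?hi_mkletter.
have crab : crosses (strands a) (strands b).
  by apply: crosses_letters; rewrite ?lo_mkletter ?hi_mkletter.
pose t := gen a * gen b * gen a * gen b.
have pt : cactus_perm t = 1.
  apply/permP => i; apply: ord_inj.
  rewrite !cactus_permM !gen_perm !permM perm1.
  rewrite !letter_permE !lo_mkletter !hi_mkletter /flip.
  by have := ltn_ord i; repeat case: ifP; lia.
(* Position 4 stays in the image of [A] and is in neither interval, so this
   image is never the set reversed by the next letter. *)
have out c : c = a \/ c = b -> Ordinal (andP h).2 \notin strands c.
  by case=> ->; rewrite inE lo_mkletter hi_mkletter /=; lia.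
have step g c : c = a \/ c = b -> Ordinal (andP h).2 \in moved g A ->
  (Ordinal (andP h).2 \in moved (g * gen c) A) /\ beyond (g * gen c) A = beyond g A.
  move=> /out oc ig; split; last first.
    by apply: beyond_gen_right; apply: contraNneq oc => ->.
  by rewrite movedM moved_gen mem_letter letter_perm_out.
have i0 : Ordinal (andP h).2 \in moved u A.
  by rewrite moved_pure // inE lo_mkletter hi_mkletter /=.
have [i1 e1] := step _ a (or_introl erefl) i0.
have [i2 e2] := step _ b (or_intror erefl) i1.
have [i3 e3] := step _ a (or_introl erefl) i2.
have [i4 e4] := step _ b (or_intror erefl) i3.
have utA : beyond (u * t) A by rewrite /t !mulgA e4 e3 e2 e1.
have push x y g : crosses (strands y) (strands x) -> beyond g (strands x) ->
  beyond (gen y * g) (strands y).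
  by move=> cr gx; rewrite beyond_gen_left (beyond_crosses _ gx) // crossesC.
have crba : crosses (strands b) (strands a) by rewrite crossesC.
have tua : beyond (t * u) (strands a).
  (* Ping-pong, starting from the wall of [2..4]. *)
  have p1 := push (mkletter h) b u (crA b (or_intror erefl)) uA.
  have p2 := push a b _ crba (push b a _ crab p1).
  by rewrite /t -!mulgA; apply: push crab p2.
rewrite cu // in utA.
have := beyond_crosses (crA a (or_introl erefl)) tua.
by rewrite utA.
Qed.

Lemma pure_central_trivial u : (5 <= n)%N -> pure_central u -> u = 1.
Proof.
move=> n5 cu; apply/eqP/contraT => u1.
have [|a [pa ua]] := exists_beyond _ (proj1 cu) u1; first lia.
have h12 : (1 < 2 < n)%N by lia.
have h24 : (2 < 4 < n)%N by lia.
case: (@not_central_beyond_24 h24).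
apply: central_beyond_right (central_beyond_12 h12 pa _);
  rewrite ?lo_mkletter ?hi_mkletter //.
by exists u.
Qed.

End PureCenter.

(** * Forgetting a strand *)

Section ForgetStrand.
Local Open Scope group_scope.
Variable n : nat.
Implicit Types (i j k l p : nat).

Lemma sgen_diag i : sgen n i i = 1.
Proof. by rewrite /sgen /gen_word insubF //= ltnn. Qed.

(** Forgetting a strand may shrink an interval to one strand, where [sgen] is
    trivial; the relations of [J_n] are needed for these degenerate intervals
    too. *)
Lemma sgenC_le i j k l : (i <= j < k)%N -> (k <= l < n)%N ->
  sgen n i j * sgen n k l = sgen n k l * sgen n i j.
Proof.
have [->|ij] := eqVneq i j; first by rewrite sgen_diag mul1g mulg1.
have [->|kl] := eqVneq k l; first by rewrite sgen_diag mul1g mulg1.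
by move=> *; apply: sgenC; lia.
Qed.

Lemma sgenN_le i j k l k' l' : (i <= k <= l)%N -> (l <= j < n)%N ->
  k' = (i + j - l)%N -> l' = (i + j - k)%N ->
  sgen n i j * sgen n k l = sgen n k' l' * sgen n i j.
Proof.
have [->|kl] := eqVneq k l => h1 h2.
  by move=> -> ->; rewrite !sgen_diag mul1g mulg1.
by apply: sgenN; lia.
Qed.

(** The interval of [a] without the position [p], with the later positions
    shifted down by one. *)
Definition letter_forget p (a : letter n.+1) : cactus n :=
  sgen n (lo a - (p < lo a)) (hi a - (p <= hi a)).

Fixpoint word_forget p (w : word n.+1) : cactus n :=
  if w is a :: w' then letter_forget p a * word_forget (flip (lo a) (hi a) p) w'
  else 1.

Lemma word_forget_cat (p : 'I_n.+1) (u v : word n.+1) :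
  word_forget p (u ++ v) = word_forget p u * word_forget (word_perm u p) v.
Proof.
elim: u p => [|a u IH] p /=; first by rewrite /word_perm big_nil perm1 mul1g.
by rewrite -letter_permE IH mulgA /word_perm big_cons permM.
Qed.

(** Each relation of [J_(n+1)] becomes the same relation, possibly degenerate,
    between the intervals without the forgotten strand. *)
Lemma word_forget_relator (p : 'I_n.+1) (u v : word n.+1) : cactus_relator u v ->
  word_forget p u = word_forget p v.
Proof.
have ltp := ltn_ord p.
case=> [a|a b h|a b c h1 h2 ec1 ec2]; rewrite /= !mulg1 /letter_forget.
- have ha := lo_hi a; set q := flip _ _ _.
  have -> : (q < lo a)%N = (p < lo a)%N by rewrite /q /flip; case: ifP; lia.
  have -> : (q <= hi a)%N = (p <= hi a)%N by rewrite /q /flip; case: ifP; lia.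
  exact: sgen2.
- have ha := lo_hi a; have hb := lo_hi b.
  set q := flip (lo a) _ _; set q' := flip (lo b) _ _.
  have -> : (q < lo b)%N = (p < lo b)%N by rewrite /q /flip; case: ifP; lia.
  have -> : (q <= hi b)%N = (p <= hi b)%N by rewrite /q /flip; case: ifP; lia.
  have -> : (q' < lo a)%N = (p < lo a)%N by rewrite /q' /flip; case: ifP; lia.
  have -> : (q' <= hi a)%N = (p <= hi a)%N by rewrite /q' /flip; case: ifP; lia.
  by apply: sgenC_le; lia.
have ha := lo_hi a; have hb := lo_hi b; rewrite ec1 ec2.
set q := flip (lo a) _ _; set q' := flip (lo a + _ - _)%N _ _.
have -> : (q' < lo a)%N = (p < lo a)%N by rewrite /q' /flip; case: ifP; lia.
have -> : (q' <= hi a)%N = (p <= hi a)%N by rewrite /q' /flip; case: ifP; lia.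
by apply: sgenN_le; rewrite /q /flip; case: ifP; lia.
Qed.

Definition forget p (s : cactus n.+1) : cactus n := word_forget p (repr s).

Lemma forgetE (p : 'I_n.+1) w : forget p (word_class w) = word_forget p w.
Proof.
apply: (word_equiv_ind (f := word_forget p)) (word_equiv_repr w) => u v l r lr.
rewrite !word_forget_cat (word_forget_relator _ lr) (relator_perm lr).
by rewrite /word_perm.
Qed.

Lemma letter_forget_expand (p : 'I_n) (a : letter n) :
  word_forget (right_child p) (letter_expand p a) = word_class [:: a].
Proof.
have ha := lo_hi a; have ltp := ltn_ord p.
have -> : word_class [:: a] = sgen n (lo a) (hi a).
  by rewrite /sgen (gen_wordE ha); congr (word_class [:: _]); apply: letter_eq.
rewrite /letter_expand.
have [q1|q1] := boolP (hi a < p)%N.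
  have h : (lo a < hi a < n.+1)%N by lia.
  rewrite (gen_wordE h) /= mulg1 /letter_forget /lo /hi /= -/(lo a) -/(hi a).
  by congr sgen; rewrite /bump; lia.
have [q2|q2] := boolP (p < lo a)%N.
  have h : ((lo a).+1 < (hi a).+1 < n.+1)%N by lia.
  rewrite (gen_wordE h) /= mulg1 /letter_forget /lo /hi /= -/(lo a) -/(hi a).
  by congr sgen; rewrite /bump; lia.
have h1 : (p < p.+1 < n.+1)%N by lia.
have h2 : (lo a < (hi a).+1 < n.+1)%N by lia.
rewrite (gen_wordE h1) (gen_wordE h2) /= mulg1 /letter_forget /lo /hi /= -/(lo a) -/(hi a).
have -> : flip p p.+1 (bump 0 p) = p by rewrite /flip /bump; case: ifP; lia.
rewrite /bump.
have -> : (p.+1 - (1 + p <= p.+1))%N = p by lia.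
have -> : (p - (1 + p < p))%N = p by lia.
by rewrite sgen_diag mul1g; congr sgen; rewrite ?/bump; lia.
Qed.

Lemma word_forget_expand (p : 'I_n) w :
  word_forget (right_child p) (word_expand p w) = word_class w.
Proof.
elim: w p => [//|a w IH] p.
rewrite -[word_expand p _]/(letter_expand p a ++ word_expand (letter_perm a p) w).
rewrite word_forget_cat letter_forget_expand letter_expand_perm perm_expand_right.
by rewrite IH -word_class_cat.
Qed.

(** The new strand of an expansion runs parallel to an old one, and the
    letter that flips both becomes trivial when the new strand is forgotten.
    In particular expansions are injective. *)
Lemma cactus_expandK (p : 'I_n) : cancel (cactus_expand p) (forget (right_child p)).
Proof.
move=> s; have [w ->] := word_class_surj s.
by rewrite cactus_expandE forgetE word_forget_expand.
Qed.

End ForgetStrand.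

(** * The kernel of [pibar] and its center *)

Section Kernel.
Local Open Scope group_scope.
Local Notation K := cactus_system.
Local Notation star := (clos_refl_trans _ (@expansion _)).

Definition trivial_label (x : tree_pair K) : Prop :=
  let: existT n (p, s, m) := x in s = 1 :> cactus n.

(** Labels cannot become trivial by expansion, by [cactus_expandK]. *)
Lemma trivial_label_star (x y : tree_pair K) :
  star x y -> trivial_label y -> trivial_label x.
Proof.
elim=> [_ _ [n p s m i] /= e|//|{}x {}y z _ IH1 _ IH2 /IH2/IH1 //].
by apply: (can_inj (cactus_expandK i)); rewrite cactus_expand1.
Qed.

Lemma diag_class_eq1 n (p : ntree n) (s : cactus n) :
  pair_class (@tpair K n p s p) = 1 :> CV -> s = 1.
Proof.
move/pair_classP/pair_equiv_join => [z xz /pair_id_star iz].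
apply: (trivial_label_star xz).
have [|n' [t ->]] := iz; last by [].
by exists 1%N, leaf1.
Qed.

Lemma diag_classM n (p : ntree n) (s r : cactus n) :
  pair_class (@tpair K n p s p) * pair_class (@tpair K n p r p) =
  pair_class (@tpair K n p (s * r) p) :> CV.
Proof. exact: (tmulE (@PairMul K n p p p s r)). Qed.

Lemma pair_perm_star (x y : tree_pair K) : star x y -> star (pair_perm x) (pair_perm y).
Proof.
elim=> [_ _ [n p s m i]|{}x|{}x {}y z _ h1 _ h2].
- apply: rt_step; rewrite /= cactus_perm_expand.
  exact: (@Expansion perm_system n p (cactus_perm s) m i).
- exact: rt_refl.
exact: rt_trans h1 h2.
Qed.

(** Any family of trees with unboundedly many leaves would do: joining with
    [comb k] makes representatives large. *)
Fixpoint comb k : tree := if k is k'.+1 then Node Leaf (comb k') else Leaf.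

Lemma nleaves_comb k : nleaves (comb k) = k.+1.
Proof. by elim: k => //= k ->. Qed.

(** The image in [V] is trivial, so it has an expansion with two equal trees and
    trivial permutation. The same expansions can be performed in [CV], and more of
    them if more leaves are desired. *)
Lemma kernel_diag (g : CV) k : pibar g = 1 ->
  exists n (t : ntree n) (s : cactus n),
    [/\ (k <= n)%N, cactus_perm s = 1 & g = pair_class (@tpair K n t s t)].
Proof.
have [x ->] := pair_class_surj g; rewrite pibarE.
move/pair_classP/pair_equiv_join => [z xz /pair_id_star iz].
have {}iz : pair_id z by apply: iz; exists 1%N, leaf1.
have ltE (y : tree_pair K) : ltree (pair_perm y) = ltree y by case: y => n [[p s] m].
have xz' := star_tle xz; rewrite ltE in xz'.
have [y xy ey] := star_reach (tle_trans xz' (tle_joinl _ (comb k))).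
have [z' zz' ez'] := star_reach (tle_joinl (ltree z) (comb k)).
have e : pair_perm y = z'.
  apply: (star_det (pair_perm_star xy) (rt_trans _ _ _ _ _ xz zz')).
  by rewrite ltE ey ez'.
have {iz} := pair_id_star iz zz'; rewrite -e => -[n' [t et]].
case: y ey xy e et => n [[p s] m] ey xy e et.
have en : n' = n by case: et.
subst n'; case/tpair_inj: et => ep es em; subst p m.
exists n, t, s; split=> //; last by rewrite (pair_class_star xy).
have := tle_nleaves (tle_joinr (ltree z) (comb k)).
by rewrite -ey nleaves_comb nleaves_ltree /=; lia.
Qed.

Lemma diag_class_kernel n (t : ntree n) (r : cactus n) : cactus_perm r = 1 ->
  pair_class (@tpair K n t r t) \in pibar_ker.
Proof.
move=> pr; apply/pibar_kerP; rewrite pibarE /= pr.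
exact: toneE.
Qed.

(** Commuting with the classes of [(t, r, t)] only says that the commutator of
    labels has trivial class; [diag_class_eq1] gives back an equality in [J_n]. *)
Lemma kernel_center (g : CV) : g \in pibar_ker ->
  (forall h : CV, h \in pibar_ker -> g * h = h * g) -> g = 1.
Proof.
move=> /pibar_kerP /(kernel_diag 5)[n [t [s [n5 ps ->]]]] cg.
suff -> : s = 1 by apply: toneE.
apply: (pure_central_trivial n5); split=> // r pr.
have := cg _ (diag_class_kernel t pr); rewrite !diag_classM => e.
have {e} : pair_class (@tpair K n t (s * r * (r * s)^-1) t) = 1 :> CV.
  rewrite -diag_classM e diag_classM mulgV; exact: toneE.
by move/diag_class_eq1 => /divg1_eq.
Qed.
End Kernel.

(** * Fixed points and the center of [CV] *)

Section Points.
Implicit Types (t p q l r : tree) (b : nat -> bool).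

(** A sequence of booleans is a point of the Cantor set on which [V] acts;
    it descends the tree, [true] being the right child, and [rest] is what
    remains of it below the leaf reached. *)
Fixpoint leaf_at t b : nat :=
  if t is Node l r then
    if b 0%N then (nleaves l + leaf_at r (fun k => b k.+1))%N
    else leaf_at l (fun k => b k.+1)
  else 0%N.

Fixpoint rest t b : nat -> bool :=
  if t is Node l r then
    if b 0%N then rest r (fun k => b k.+1) else rest l (fun k => b k.+1)
  else b.

Lemma leaf_at_lt t b : (leaf_at t b < nleaves t)%N.
Proof.
elim: t b => //= l IHl r IHr b; case: ifP => _; first by rewrite ltn_add2l.
exact: leq_trans (IHl _) (leq_addr _ _).
Qed.

Lemma leaf_at_attach t i b : (i < nleaves t)%N ->
  leaf_at (attach t i) b =
    if leaf_at t b == i then (i + rest t b 0)%N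
    else (leaf_at t b + (i < leaf_at t b))%N.
Proof.
elim: t i b => [|l IHl r IHr] i b /= lti.
  by have -> : i = 0%N by [lia]; case: (b 0%N).
have := leaf_at_lt l (fun k => b k.+1); have [q|q] := ltnP i (nleaves l) => /=.
  case: ifP => _ lt; last exact: IHl.
  by rewrite nleaves_attach; case: eqP; lia.
case: ifP => _ lt; last by case: eqP; lia.
rewrite IHr; last lia.
by case: eqP; case: eqP; lia.
Qed.

Lemma rest_attach t i b : (i < nleaves t)%N ->
  rest (attach t i) b =
    if leaf_at t b == i then (fun k => rest t b k.+1) else rest t b.
Proof.
elim: t i b => [|l IHl r IHr] i b /= lti.
  by have -> : i = 0%N by [lia]; case: (b 0%N).
have := leaf_at_lt l (fun k => b k.+1); have [q|q] := ltnP i (nleaves l) => /=.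
  by case: ifP => _ lt; [rewrite ifF //; lia|apply: IHl].
case: ifP => _ lt; last by rewrite ifF //; lia.
rewrite IHr; last lia.
by congr (if _ then _ else _); lia.
Qed.

Definition point_cons (c : bool) b : nat -> bool :=
  fun k => if k is k'.+1 then b k' else c.

Lemma leaf_at_surj t k : (k < nleaves t)%N -> exists b, leaf_at t b = k.
Proof.
elim: t k => [|l IHl r IHr] k /= ltk; first by exists (fun=> false); lia.
have [/IHl[b <-]|q] := ltnP k (nleaves l); first by exists (point_cons false b).
have [|b e] := IHr (k - nleaves l)%N; first lia.
by exists (point_cons true b); rewrite /= e; lia.
Qed.

(** A tree is determined by the partition of the Cantor set into the sets of
    sequences through each leaf, whatever the numbering of the parts. *)
Lemma tree_eq_leaf_at p q :
  (forall b b', leaf_at p b = leaf_at p b' <-> leaf_at q b = leaf_at q b') -> p = q.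
Proof.
have sep l r : leaf_at (Node l r) (fun=> false) <> leaf_at (Node l r) (fun=> true).
  by have := leaf_at_lt l (fun=> false) => /=; lia.
elim: p q => [|l IHl r IHr] [|l' r'] // h.
- by case: (sep l' r'); apply/h.
- by case: (sep l r); apply/h.
congr Node; [apply: IHl|apply: IHr] => b b'.
  exact: (h (point_cons false b) (point_cons false b')).
have := h (point_cons true b) (point_cons true b').
rewrite /= => -[h1 h2]; split=> e; first by apply: (addnI (h1 _)); rewrite e.
by apply: (addnI (h2 _)); rewrite e.
Qed.

Definition leaf_ord n (t : ntree n) b : 'I_n :=
  Ordinal (leq_trans (leaf_at_lt (val t) b) (eq_leq (eqP (valP t)))).

Lemma leaf_ord_attach n (t : ntree n) (i : 'I_n) b :
  leaf_ord (nattach t i) b =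
    if leaf_ord t b == i then
      if rest (val t) b 0%N then right_child i else old_leaf i i
    else old_leaf i (leaf_ord t b).
Proof.
apply: ord_inj; rewrite /= leaf_at_attach ?(eqP (valP t)) //.
rewrite -(inj_eq val_inj) /=; case: eqP => e /=.
  by case: (rest _ _ _) => /=; rewrite /bump; lia.
by rewrite /bump; lia.
Qed.

Lemma rest_nattach n (t : ntree n) (i : 'I_n) b :
  rest (val (nattach t i)) b =
    if leaf_ord t b == i then (fun k => rest (val t) b k.+1) else rest (val t) b.
Proof. by rewrite /= rest_attach ?(eqP (valP t)). Qed.

Section Fixed.
Variable K : cloning_system.

(** The pair [(p, s, m)] sends the sequence through leaf [i] of [p] to the sequence
    through leaf [s i] of [m] with the same rest. Only its fixed points are
    considered. *)
Definition fixes (x : tree_pair K) b : Prop :=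
  let: existT n (p, s, m) := x in
  csperm s (leaf_ord p b) = leaf_ord m b /\ rest (val p) b =1 rest (val m) b.

Lemma fixesE n (p : ntree n) (s : K n) (m : ntree n) b :
  fixes (tpair p s m) b =
  (csperm s (leaf_ord p b) = leaf_ord m b /\ rest (val p) b =1 rest (val m) b).
Proof. by []. Qed.

(** The first term of the rest says which child of the new caret a sequence goes
    through, and the induced bijection respects left and right children. *)
Lemma fixes_expansion (x y : tree_pair K) b : expansion x y -> fixes x b <-> fixes y b.
Proof.
case=> n p s m i; rewrite !fixesE !leaf_ord_attach !rest_nattach csperm_expand.
have old_inj (j k k' : 'I_n) : old_leaf j k = old_leaf j k' -> k = k' by apply: lift_inj.
have neq (j k : 'I_n) : old_leaf j k <> right_child j.
  by move/eqP; rewrite eq_sym (negPf (neq_lift _ _)).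
set k := leaf_ord p b; set k' := leaf_ord m b.
have [->|ki] := eqVneq k i; last first.
  have ski : csperm s k != csperm s i by rewrite (inj_eq perm_inj).
  rewrite perm_expand_old; split=> [[<- e]|]; first by rewrite (negPf ski).
  have [_ [e _]|_ [/old_inj e er]] := eqVneq k' (csperm s i); last by [].
  by case: ifP e => _ => [/neq //|/old_inj e]; rewrite e eqxx in ski.
split=> [[<- e]|[]].
  rewrite eqxx -!e; split; last by move=> j; apply: e.
  by case: (rest _ _ _); rewrite ?perm_expand_right ?perm_expand_old.
have [->|ne] := eqVneq k' (csperm s i).
  move=> e er; split=> // -[|j]; last exact: er.
  case: (rest _ _ _) e; case: (rest _ _ _) => //.
    by rewrite perm_expand_right => /esym/neq.
  by rewrite perm_expand_old => /neq.
case: ifP => _; first by rewrite perm_expand_right => /esym/neq.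
by rewrite perm_expand_old => /old_inj e; rewrite e eqxx in ne.
Qed.

Lemma fixes_class (x y : tree_pair K) b :
  pair_class x = pair_class y -> fixes x b <-> fixes y b.
Proof.
move/pair_classP.
elim=> [{}x {}y /fixes_expansion //|//|{}x {}y _ IH|{}x {}y z _ IH1 _ IH2].
  by split=> /IH.
by split=> [/IH1/IH2|/IH2/IH1].
Qed.

End Fixed.

(** An adjacent transposition moving [j] usually works; in the corner cases where
    it would move [i], the flip of three strands centered at [i] does. *)
Lemma letter_separates n (i j : 'I_n) : (3 <= n)%N -> i != j ->
  exists a : letter n, letter_perm a i = i /\ letter_perm a j != j.
Proof.
move=> n3 ne; have {}ne : i <> j :> nat by move/ord_inj/eqP; apply/negP.
have lti := ltn_ord i; have ltj := ltn_ord j.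
suff [k [m [h [h1 h2]]]] : exists k m, exists _ : (k < m < n)%N,
    flip k m i = i /\ flip k m j <> j.
  exists (mkletter h); split; first by apply: ord_inj; rewrite letter_permE.
  by apply/eqP => /(congr1 val); rewrite /= letter_permE.
have [q1|q1] := boolP ((j.+1 < n) && (i != j.+1 :> nat))%N.
  have h : (j < j.+1 < n)%N by lia.
  by exists j, j.+1, h; rewrite /flip; split; case: ifP; lia.
have [q2|q2] := boolP ((0 < j) && (i != j.-1 :> nat))%N.
  have h : (j.-1 < j < n)%N by lia.
  by exists j.-1, (j : nat), h; rewrite /flip; split; case: ifP; lia.
have [q3|q3] := eqVneq (j : nat) 0%N.
  have h : (0 < 2 < n)%N by lia.
  by exists 0%N, 2%N, h; rewrite /flip; split; case: ifP; lia.
have h : (j - 2 < j < n)%N by lia.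
by exists (j - 2)%N, (j : nat), h; rewrite /flip; split; case: ifP; lia.
Qed.

Local Open Scope group_scope.
Local Notation K := cactus_system.

(** Conjugating the class of [(p, r, p)] by [g], the class of [(p, s, q)], gives
    that of [(q, s^-1 r s, q)]. The sequences fixed by the first are those whose
    leaf of [p] is fixed by [r]; by the second, those whose leaf of [q] is the
    image by [s] of a leaf fixed by [r]. Letting [r] vary identifies the leaves. *)
Lemma center_kernel (g : CV) : (forall h : CV, g * h = h * g) -> g \in pibar_ker.
Proof.
move=> cg; have [x0 e0] := pair_class_surj g.
have [x xx ex] := star_reach (tle_joinl (ltree x0) (comb 3)).
have e : g = pair_class x by rewrite e0; apply: pair_class_star.
(* Three leaves are needed to separate two of them by a letter. *)
have x3 : (3 <= tag x)%N.
  rewrite -nleaves_ltree ex; have := tle_nleaves (tle_joinr (ltree x0) (comb 3)).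
  by rewrite nleaves_comb; lia.
case: x x3 e {xx ex} => n [[p s] q] /= n3 e.
have conj (r : cactus n) :
    pair_class (@tpair K n p r p) = pair_class (@tpair K n q (s^-1 * r * s) q).
  apply: (mulgI g); rewrite cg e.
  rewrite (tmulE (@PairMul K n p p q r s) : _ * _ = _ :> CV).
  rewrite (tmulE (@PairMul K n p q q s (s^-1 * r * s)) : _ * _ = _ :> CV).
  by rewrite !mulgA mulgV mul1g.
have leafE b : leaf_ord q b = cactus_perm s (leaf_ord p b).
  apply/eqP; rewrite -(inj_eq (@perm_inj _ (cactus_perm s)^-1)) permK eq_sym.
  apply/contraT => ne; have [a [ai aj]] := letter_separates n3 ne.
  have [h _] := fixes_class b (conj (gen a)).
  have [|h1 _] := h; first by split=> //=; rewrite gen_perm.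
  case/negP: aj; rewrite -gen_perm; apply/eqP/(@perm_inj _ (cactus_perm s)).
  rewrite permKV -[RHS]h1 /= !cactus_permM !permM.
  have pV : cactus_perm s^-1 = (cactus_perm s)^-1 := cspermV (K := K) s.
  by rewrite pV.
have pq : p = q.
  apply/val_inj/tree_eq_leaf_at => b b'.
  have E (t : ntree n) :
      leaf_at (val t) b = leaf_at (val t) b' <-> leaf_ord t b = leaf_ord t b'.
    by split=> [h|/(congr1 val)//]; apply: val_inj.
  by rewrite !E !leafE; split=> [->//|/perm_inj].
subst q; apply/pibar_kerP; rewrite e pibarE /=.
suff -> : cactus_perm s = 1 by apply: toneE.
apply/permP => i; rewrite perm1.
have [|b eb] := @leaf_at_surj (val p) i; first by rewrite (eqP (valP p)).
have -> : i = leaf_ord p b by apply: val_inj.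
by rewrite -leafE.
Qed.

End Points.

Local Open Scope classical_set_scope.

Theorem proposition3p8 :
  center CV = [set 1%g] /\ center PCV = [set 1%g].
Proof.
split; apply/seteqP; split=> [z cz|_ -> h] /=;
  try exact: (commute_sym (commute1 h)).
- by apply: kernel_center => [|h _]; [apply: center_kernel|apply: cz].
- apply: (@val_inj CV pibar_ker PCV); apply: kernel_center => [|h hh]; first exact: valP.
  by have := cz (Sub h hh : PCV) => /(congr1 val); rewrite !valM SubK.
Qed.
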